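(* Let $q_1,q_2,r$ be distinct odd primes with $q_1,q_2\equiv1\bmod r$ but $q_1,q_2\not\equiv1\bmod r^2$, such that $q_1$ is an $r$-th power in $\mathbb Z/q_2\mathbb Z$ and $q_2$ is an $r$-th power in $\mathbb Z/q_1\mathbb Z$. Let $G=C_{q_1q_2}\rtimes C_r$ with $C_r$ acting non-trivially on both the subgroups $C_{q_1}$ and $C_{q_2}$ of $C_{q_1q_2}$. Assume Conjecture (C) holds. Then for every elliptic curve $E/\mathbb Q$ and every Galois extension $F/\mathbb Q$ with Galois group $G$, either $\mathrm{rk}\,E(F)>0$ or $$\frac{\mathrm{BSD}(E/F^{C_r})\,\mathrm{BSD}(E/\mathbb Q)}{\mathrm{BSD}(E/F^{C_{q_1}\rtimes C_r})\,\mathrm{BSD}(E/F^{C_{q_2}\rtimes C_r})}=q_1^aq_2^bm$$ for some $a,b\in\mathbb Z$ and $m\in\mathbb Q$ with $m\equiv1\bmod q_1q_2$.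
   Context: Here $C_r$ denotes a subgroup of order $r$ of $G$ (a complement to $C_{q_1q_2}$), and $C_{q_i}\rtimes C_r$ the subgroup generated by $C_{q_i}$ and $C_r$; $F^H$ is the fixed field of $H$. For $m\in\mathbb Q$, $m\equiv1\bmod q_1q_2$ means $m$ has numerator and denominator prime to $q_1q_2$ and is $1$ in $\mathbb Z/q_1q_2\mathbb Z$. Conjecture (C) is the assertion that for every elliptic curve $E/\mathbb Q$ there is a function assigning to each Artin representation $\rho$ over $\mathbb Q$ (continuous $G_{\mathbb Q}\to\mathrm{GL}(V)$ with finite image, $V$ complex) a number $\mathrm{BSD}(E,\rho)\in\mathbb C^\times$ such that, for $\rho,\tau$ factoring through $\mathrm{Gal}(K/\mathbb Q)$ with $K/\mathbb Q$ finite Galois: (C1) for every number field $F$, $\mathrm{Sha}(E/F)$ is finite and $\mathrm{BSD}(E/F)=\mathrm{BSD}(E,\mathrm{Ind}_{F/\mathbb Q}\mathbf 1)$; (C2) $\mathrm{BSD}(E,\rho\oplus\tau)=\mathrm{BSD}(E,\rho)\mathrm{BSD}(E,\tau)$; (C3) $\mathrm{BSD}(E,\rho)=\mathrm{BSD}(E,\rho^* )(-1)^rw_{E,\rho}w_\rho^{-2}$ with $r=\langle\rho,E(K)_{\mathbb C}\rangle$; (C4) if $\rho\simeq\rho^*$ then $\mathrm{BSD}(E,\rho)\in\mathbb R$ with the same sign as $w_\rho$; and if $\langle\rho,E(K)_{\mathbb C}\rangle=0$: (C5) $\mathrm{BSD}(E,\rho)\in\mathbb Q(\rho)^\times$ and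 $\mathrm{BSD}(E,\rho^{\mathfrak g})=\mathrm{BSD}(E,\rho)^{\mathfrak g}$ for $\mathfrak g\in\mathrm{Gal}(\mathbb Q(\rho)/\mathbb Q)$; (C6) if $\rho$ is a non-trivial primitive Dirichlet character of order $d$ and either $\mathfrak f_E,\mathfrak f_\rho$ are coprime or $E$ is semistable with no non-trivial isogenies over $\mathbb Q$, then $\mathrm{BSD}(E,\rho)\in\mathbb Z[\zeta_d]$. Here $\rho^*$ is the dual, $\mathbb Q(\rho)$ the field of character values, $\rho^{\mathfrak g}$ has character $\mathfrak g\circ\mathrm{Tr}\rho$, $w_\rho,\mathfrak f_\rho$ the Artin root number and conductor, $w_{E,\rho}$ the root number of the twist, $\mathfrak f_E$ the conductor of $E$, $\langle\rho,E(K)_{\mathbb C}\rangle$ the character inner product with $E(K)\otimes\mathbb C$. $\mathrm{BSD}(E/F)=\frac{\mathrm{Reg}_{E/F}|\mathrm{Sha}(E/F)|C_{E/F}}{|E(F)_{\mathrm{tors}}|^2}$, $C_{E/F}=\prod_v c_v(E/F)|\omega/\omega_v^{\min}|_v$ (finite places; Tamagawa numbers $c_v$; $\omega$ global minimal differential of $E/\mathbb Q$). Dirichlet characters are identified with 1-dimensional Artin representations via $\sigma_a\leftrightarrow a$, $\sigma_a(\zeta_n)=\zeta_n^a$. *)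

(* Defs.v *)
(* Representations have coefficients in
   R[i] for R : realType; the algebraic closure of rat is algC and its
   absolute Galois group is represented by {rmorphism algC -> algC} (every ring
   endomorphism of algC is an automorphism).

   Several invariants below (Tamagawa numbers, regulators, orders of Sha, root
   numbers, conductors) are specified by a predicate that classical theorems
   show to have exactly one solution; [xget] then extracts that solution. *)
From HB Require Import structures.
From mathcomp Require Import all_boot all_order all_algebra all_fingroup.
From mathcomp Require Import all_solvable all_field.
From mathcomp Require Import complex.
From mathcomp Require Import all_classical all_reals all_analysis.

Set Implicit Arguments.
Unset Strict Implicit.
Unset Printing Implicit Defensive.

Import Order.TTheory GRing.Theory Num.Theory.
Import numFieldNormedType.Exports.

Local Open Scope classical_set_scope.
Local Open Scope ring_scope.

Notation absgal := {rmorphism algC -> algC}.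

(* A modulo e has exactly n classes (e an equivalence relation on A). *)
Definition has_classes (T : Type) (A : set T) (e : T -> T -> Prop) (n : nat) :=
  exists f : 'I_n -> T,
    [/\ forall i, A (f i),
        forall i k, e (f i) (f k) -> i = k
      & forall x, A x -> exists i, e x (f i)].

Definition quot_card (T : Type) (A : set T) (e : T -> T -> Prop) : nat :=
  xget 0%N [set n | has_classes A e n].

Record weierstrass (K : Type) :=
  Weierstrass { a1 : K; a2 : K; a3 : K; a4 : K; a6 : K }.

Definition wmap (K L : Type) (f : K -> L) (W : weierstrass K) :=
  Weierstrass (f (a1 W)) (f (a2 W)) (f (a3 W)) (f (a4 W)) (f (a6 W)).

(* None is the point at infinity. *)
Definition point (K : Type) := option (K * K).

Definition pmap (K L : Type) (f : K -> L) (P : point K) : point L :=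
  if P is Some (x, y) then Some (f x, f y) else None.

Section Weierstrass.
Variable K : fieldType.
Implicit Types (W : weierstrass K) (P Q : point K).

Definition b2 W := a1 W ^+ 2 + 4 * a2 W.
Definition b4 W := 2 * a4 W + a1 W * a3 W.
Definition b6 W := a3 W ^+ 2 + 4 * a6 W.
Definition b8 W := a1 W ^+ 2 * a6 W + 4 * a2 W * a6 W - a1 W * a3 W * a4 W
                   + a2 W * a3 W ^+ 2 - a4 W ^+ 2.
Definition c4 W := b2 W ^+ 2 - 24 * b4 W.
Definition disc W := - (b2 W ^+ 2 * b8 W) - 8 * b4 W ^+ 3 - 27 * b6 W ^+ 2
                     + 9 * b2 W * b4 W * b6 W.
Definition jinv W := c4 W ^+ 3 / disc W.

Definition elliptic W : Prop := disc W != 0.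

(* The equation in x', y' where x = u^2 x' + r and y = u^3 y' + u^2 s x' + t. *)
Definition wchange (u r s t : K) W := Weierstrass
  ((a1 W + 2 * s) / u)
  ((a2 W - s * a1 W + 3 * r - s ^+ 2) / u ^+ 2)
  ((a3 W + r * a1 W + 2 * t) / u ^+ 3)
  ((a4 W - s * a3 W + 2 * r * a2 W - (t + r * s) * a1 W + 3 * r ^+ 2
    - 2 * s * t) / u ^+ 4)
  ((a6 W + r * a4 W + r ^+ 2 * a2 W + r ^+ 3 - t * a3 W - t ^+ 2
    - r * t * a1 W) / u ^+ 6).

Definition on_curve W : set (point K) := fun P =>
  if P is Some (x, y) then
    y ^+ 2 + a1 W * x * y + a3 W * y = x ^+ 3 + a2 W * x ^+ 2 + a4 W * x + a6 W
  else True.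

Definition popp W P : point K :=
  if P is Some (x, y) then Some (x, - y - a1 W * x - a3 W) else None.

Definition padd W P Q : point K :=
  match P, Q with
  | None, _ => Q
  | _, None => P
  | Some (x1, y1), Some (x2, y2) =>
    if (x1 == x2) && (y1 + y2 + a1 W * x2 + a3 W == 0) then None else
    let lam := if x1 == x2
      then (3 * x1 ^+ 2 + 2 * a2 W * x1 + a4 W - a1 W * y1)
             / (2 * y1 + a1 W * x1 + a3 W)
      else (y2 - y1) / (x2 - x1) in
    let nu := if x1 == x2
      then (- x1 ^+ 3 + a4 W * x1 + 2 * a6 W - a3 W * y1)
             / (2 * y1 + a1 W * x1 + a3 W)
      else (y1 * x2 - y2 * x1) / (x2 - x1) in
    let x3 := lam ^+ 2 + a1 W * lam - a2 W - x1 - x2 in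
    Some (x3, - (lam + a1 W) * x3 - nu - a3 W)
  end.

Definition psub W P Q := padd W P (popp W Q).

Definition pmuln W (n : nat) P : point K := iter n (padd W P) None.

Definition pmulz W (n : int) P : point K :=
  match n with Posz k => pmuln W k P | Negz k => popp W (pmuln W k.+1 P) end.

Definition lincomb W m (P : 'I_m -> point K) (n : 'I_m -> int) : point K :=
  \big[padd W/None]_(i < m) pmulz W (n i) (P i).

Definition torsion W : set (point K) :=
  [set P | on_curve W P /\ exists n, (0 < n)%N /\ pmuln W n P = None].

Definition n_torsion W (n : nat) : set (point K) :=
  [set P | on_curve W P /\ pmuln W n P = None].

Definition independent W m (P : 'I_m -> point K) :=
  (forall i, on_curve W (P i)) /\
  (forall n, torsion W (lincomb W P n) -> forall i, n i = 0).

(* P is a basis of the group of points modulo torsion. *)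
Definition mw_basis W m (P : 'I_m -> point K) :=
  independent W P /\
  forall Q, on_curve W Q ->
    exists n, exists2 T, torsion W T & Q = padd W T (lincomb W P n).

Definition rank_ge W (m : nat) := exists P : 'I_m -> point K, independent W P.

End Weierstrass.

Definition wbase (E : weierstrass rat) (K : fieldType) : weierstrass K :=
  wmap (fun x : rat => ratr x : K) E.

Section Places.
Variable K : fieldType.
Implicit Types (v : K -> int) (W : weierstrass K).

(* Normalised discrete valuations; on a number field these are exactly the
   finite places.  The value at 0 carries no meaning and is pinned to 0 so that
   a place is a unique function. *)
Definition place : set (K -> int) := [set v |
  [/\ v 0 = 0,
      forall x y, x != 0 -> y != 0 -> v (x * y) = v x + v y,
      forall x y, x != 0 -> y != 0 -> x + y != 0 ->
        Num.min (v x) (v y) <= v (x + y)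
    & exists2 x, x != 0 & v x = 1]].

Definition vge v (n : int) (x : K) : Prop := x = 0 \/ n <= v x.

Definition residue_card v : nat :=
  quot_card (vge v 0) (fun x y => vge v 1 (x - y)).

Definition vabs (R : realType) v (x : K) : R :=
  if x == 0 then 0 else (residue_card v)%:R ^ (- v x).

Definition integral_at v W :=
  [/\ vge v 0 (a1 W), vge v 0 (a2 W), vge v 0 (a3 W), vge v 0 (a4 W)
    & vge v 0 (a6 W)].

Definition minimal_at v W := integral_at v W /\
  forall u r s t, u != 0 -> integral_at v (wchange u r s t W) ->
    v (disc W) <= v (disc (wchange u r s t W)).

(* For W integral at v: the points with non-singular reduction. *)
Definition nonsing_red v W : set (point K) := fun P =>
  if P is Some (x, y) then
    vge v 0 x -> vge v 0 y ->
    ~ (vge v 1 (2 * y + a1 W * x + a3 W) /\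
       vge v 1 (3 * x ^+ 2 + 2 * a2 W * x + a4 W - a1 W * y))
  else True.

End Places.

Section Completion.
Variable K : fieldType.
Implicit Types (v : K -> int) (W : weierstrass K).

(* (L, w) is the completion of (K, v) through i. *)
Definition is_completion v (L : fieldType) (i : {rmorphism K -> L})
    (w : L -> int) :=
  [/\ place w,
      forall x, w (i x) = v x,
      forall y n, exists x, vge w n (y - i x)
    & forall a : nat -> L,
        (forall n, exists N, forall k l, (N <= k)%N -> (N <= l)%N ->
           vge w n (a k - a l)) ->
        exists y, forall n, exists N, forall k, (N <= k)%N ->
           vge w n (a k - y)].

Definition tamagawa v W : nat := xget 0%N [set n |
  exists u r s t (L : fieldType) (i : {rmorphism K -> L}) w,
    let W' := wchange u r s t W in let WL := wmap i W' in
    [/\ u != 0, minimal_at v W', is_completion v i w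
      & has_classes (on_curve WL)
          (fun P Q => on_curve WL (psub WL P Q) /\
                      nonsing_red w WL (psub WL P Q)) n]].

(* |omega / omega_v^min|_v for omega = dx / (2y + a1 x + a3) on W: changing
   variables by (u, r, s, t) gives omega = u^-1 omega'. *)
Definition diff_factor (R : realType) v W : R := xget 0 [set z |
  exists u r s t,
    [/\ u != 0, minimal_at v (wchange u r s t W) & z = vabs R v u^-1]].

End Completion.

Definition global_minimal (W : weierstrass rat) :=
  forall v, place v -> minimal_at v W.

Definition tamagawa_prod (R : realType) (E : weierstrass rat)
    (F : fieldExtType rat) : R := xget 0 [set z |
  exists u r s t,
    let W := wchange u r s t E in
    [/\ u != 0, global_minimal W
      & z = \big[*%R/1]_(v \in place (K := F))
              ((tamagawa v (wbase W F))%:R * diff_factor R v (wbase W F))]].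

Section Heights.
Variables (R : realType) (F : fieldExtType rat).

Definition complex_embeddings : set (F -> R[i]) :=
  [set f : F -> R[i] | exists g : {rmorphism F -> R[i]}, f = (g : F -> R[i])].

(* Relative to F, hence no division by [F : Q]; a pair of conjugate complex
   embeddings contributes the square of the usual modulus. *)
Definition log_height (x : F) : R :=
  ln ((\big[*%R/1]_(v \in place (K := F)) Num.max 1 (vabs R v x)) *
      (\big[*%R/1]_(f \in complex_embeddings)
         Num.max 1 (complex.Re `|f x|))).

Definition point_height (P : point F) : R :=
  if P is Some (x, _) then log_height x else 0.

(* The quadratic form P |-> <P, P>: twice the canonical height normalised as
   half the limit. *)
Definition nt_height (W : weierstrass F) (P : point F) : R :=
  limn (fun n : nat => point_height (pmuln W (2 ^ n) P) / 4 ^+ n).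

Definition nt_pairing (W : weierstrass F) (P Q : point F) : R :=
  (nt_height W (padd W P Q) - nt_height W P - nt_height W Q) / 2.

Definition regulator (W : weierstrass F) : R := xget 0 [set z |
  exists m (P : 'I_m -> point F), mw_basis W P /\
    z = \det (\matrix_(i < m, k < m) nt_pairing W (P i) (P k))].

End Heights.

Section Completed.
Variables (R : realType) (Om : closedFieldType) (nrm : Om -> R).

Definition abs_value :=
  [/\ forall x, 0 <= nrm x,
      forall x, nrm x = 0 <-> x = 0,
      forall x y, nrm (x * y) = nrm x * nrm y
    & forall x y, nrm (x + y) <= nrm x + nrm y].

Variables (K : fieldType) (i : K -> Om).

Definition adherence : set Om :=
  [set y | forall e : R, 0 < e -> exists x, nrm (y - i x) < e].

(* adherence is the completion of K at the place defined by nrm (finite or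
   infinite), and Om is an algebraic closure of that completion. *)
Definition completed_closure :=
  [/\ abs_value,
      exists2 x, i x != 0 & nrm (i x) != 1,
      forall a : nat -> K,
        (forall e : R, 0 < e -> exists N, forall k l, (N <= k)%N -> (N <= l)%N ->
           nrm (i (a k) - i (a l)) < e) ->
        exists y, forall e : R, 0 < e -> exists N, forall k, (N <= k)%N ->
           nrm (i (a k) - y) < e
    & forall y, exists2 p : {poly Om},
        p != 0 & (forall n, adherence p`_n) /\ root p y].

End Completed.

Section Sha.
Variables (R : realType) (E : weierstrass rat) (F : fieldExtType rat).
Variable iota : {rmorphism F -> algC}.

Definition fixes (s : absgal) :=
  forall x, s (iota x) = iota x.

Definition cochain := absgal -> point algC.

Let EC := wbase E algC.

(* Continuous 1-cocycles of the absolute Galois group of F. *)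
Definition cocycle : set cochain := [set c |
  [/\ forall s, fixes s -> on_curve EC (c s),
      forall s t u : absgal, fixes s -> fixes t -> u =1 s \o t ->
        c u = padd EC (c s) (pmap s (c t))
    & exists l : seq algC, forall s t : absgal, fixes s -> fixes t ->
        {in l, s =1 t} -> c s = c t]].

Definition cohomologous (c c' : cochain) :=
  exists2 P, on_curve EC P &
    forall s, fixes s -> c s = padd EC (c' s) (psub EC (pmap s P) P).

Definition locally_trivial (c : cochain) :=
  forall (Om : closedFieldType) (nrm : Om -> R) (emb : {rmorphism algC -> Om}),
    completed_closure nrm (emb \o iota) ->
    exists2 P, on_curve (wbase E Om) P &
      forall (s : {rmorphism Om -> Om}) (t : absgal),
        (forall y, adherence nrm (emb \o iota) y -> s y = y) ->
        emb \o t =1 s \o emb ->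
        pmap emb (c t) = psub (wbase E Om) (pmap s P) P.

Definition sha_has_card (n : nat) :=
  has_classes [set c | cocycle c /\ locally_trivial c] cohomologous n.

End Sha.

Definition sha_finite (R : realType) (E : weierstrass rat)
    (F : fieldExtType rat) :=
  forall iota : {rmorphism F -> algC}, exists n, sha_has_card R E iota n.

Definition sha_card (R : realType) (E : weierstrass rat)
    (F : fieldExtType rat) : nat := xget 0%N [set n |
  exists iota : {rmorphism F -> algC}, sha_has_card R E iota n].

Definition BSD (R : realType) (E : weierstrass rat) (F : fieldExtType rat) : R :=
  regulator R (wbase E F) * (sha_card R E F)%:R * tamagawa_prod R E F
  / (quot_card (torsion (wbase E F)) eq)%:R ^+ 2.

(* s \o t carries no canonical {rmorphism} structure as a bare function, hence
   multiplicativity is stated with a third automorphism equal to it. *)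
Record artin_rep (R : realType) (n : nat) := ArtinRep {
  arep :> absgal -> 'M[R[i]]_n;
  arep_unit : forall s, arep s \in unitmx;
  arep_mul : forall s t u : absgal, u =1 s \o t -> arep u = arep s *m arep t;
  arep_cont : exists l : seq algC, forall s : absgal, {in l, s =1 id} -> arep s = 1%:M
}.

Section ArtinOps.
Variable R : realType.

Lemma adual_unit n (rho : artin_rep R n) s : (invmx (rho s))^T \in unitmx.
Proof. by rewrite unitmx_tr unitmx_inv arep_unit. Qed.

Lemma adual_mul n (rho : artin_rep R n) (s t u : absgal) : u =1 s \o t ->
  (invmx (rho u))^T = (invmx (rho s))^T *m (invmx (rho t))^T.
Proof.
move=> ust; rewrite (arep_mul rho ust) -trmx_mul; congr trmx.
have [us ut] := (arep_unit rho s, arep_unit rho t).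
have ust' : rho s *m rho t \in unitmx by rewrite unitmx_mul us ut.
apply: (can_inj (mulKmx ust')); rewrite mulmxV //.
by rewrite mulmxA -(mulmxA (rho s)) mulmxV // mulmx1 mulmxV.
Qed.

Lemma adual_cont n (rho : artin_rep R n) :
  exists l : seq algC, forall s : absgal, {in l, s =1 id} ->
    (invmx (rho s))^T = 1%:M.
Proof.
by have [l lP] := arep_cont rho; exists l => s /lP->; rewrite invmx1 trmx1.
Qed.

Definition adual n (rho : artin_rep R n) : artin_rep R n :=
  ArtinRep (adual_unit rho) (@adual_mul n rho) (adual_cont rho).

Section Sum.
Variables (n m : nat) (rho : artin_rep R n) (tau : artin_rep R m).

Definition asum_mx s := block_mx (rho s) 0 0 (tau s).

Lemma asum_unit s : asum_mx s \in unitmx.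
Proof. by rewrite unitmxE det_ublock unitrM -!unitmxE !arep_unit. Qed.

Lemma asum_mul (s t u : absgal) : u =1 s \o t ->
  asum_mx u = asum_mx s *m asum_mx t.
Proof.
move=> ust; rewrite /asum_mx (arep_mul rho ust) (arep_mul tau ust) mulmx_block.
by rewrite !mul0mx !mulmx0 !addr0 !add0r.
Qed.

Lemma asum_cont :
  exists l : seq algC, forall s : absgal, {in l, s =1 id} -> asum_mx s = 1%:M.
Proof.
have [[l lP] [l' lP']] := (arep_cont rho, arep_cont tau).
exists (l ++ l') => s sl; rewrite /asum_mx lP ?lP' -?scalar_mx_block //.
  by move=> x xl; apply: sl; rewrite mem_cat xl orbT.
by move=> x xl; apply: sl; rewrite mem_cat xl.
Qed.

Definition asum : artin_rep R (n + m) := ArtinRep asum_unit asum_mul asum_cont.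

End Sum.

Definition aiso n (rho tau : artin_rep R n) :=
  exists2 T : 'M[R[i]]_n, T \in unitmx & forall s, rho s *m T = T *m tau s.

(* rho is the permutation representation on the embeddings of F in algC, that
   is, on the cosets of the absolute Galois group of F. *)
Definition is_ind_triv (F : fieldExtType rat) n (rho : artin_rep R n) :=
  exists e : 'I_n -> {rmorphism F -> algC},
    [/\ forall i k, e i =1 e k -> i = k,
        forall f : {rmorphism F -> algC}, exists i, f =1 e i
      & forall s i k, rho s i k = (`[< e i =1 s \o e k >] : nat)%:R].

Definition factors_through (F : fieldExtType rat) (iota : {rmorphism F -> algC})
    n (rho : artin_rep R n) :=
  forall s, fixes iota s -> rho s = 1%:M.

End ArtinOps.

Section GaloisField.
Variables (R : realType) (K : splittingFieldType rat).
Variable iota : {rmorphism K -> algC}.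

Definition galois_lift (lift : gal_of {:K} -> absgal) :=
  forall g x, lift g (iota x) = iota (g x).

(* m = <rho, E(K)_C>; A g is the matrix of g on E(K) modulo torsion. *)
Definition mw_mult (E : weierstrass rat) n (rho : artin_rep R n) (m : nat) :=
  let EK := wbase E K in
  exists d (P : 'I_d -> point K) (A : gal_of {:K} -> 'M[int]_d) lift,
    [/\ mw_basis EK P, galois_lift lift,
        forall (g : gal_of {:K}) k, exists2 T, torsion EK T &
          pmap g (P k) = padd EK T (lincomb EK P (fun l => A g l k))
      & m%:R = (#|('Gal({:K} / 1))%g|%:R)^-1 *
          \sum_(g in ('Gal({:K} / 1))%g) \tr (rho (lift g)) * (\tr (A g))%:~R
          :> R[i]].

(* Ramification groups in lower numbering; v a place of K. *)
Definition ramif_group (v : K -> int) (n : nat) : {set gal_of {:K}} :=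
  [set g in ('Gal({:K} / 1))%g |
     `[< forall x, vge v 0 x -> vge v n.+1%:Z (g x - x) >]].

End GaloisField.

Definition artin_cond_exp (R : realType) n (rho : artin_rep R n) (p : nat) :
    nat := xget 0%N [set m |
  exists (K : splittingFieldType rat) (iota : {rmorphism K -> algC}) lift v,
    let G k := ramif_group v k in
    let codim k : R[i] := #|G k|%:R / #|G 0%N|%:R *
          (n%:R - (#|G k|%:R)^-1 * \sum_(g in G k) \tr (rho (lift g))) in
    [/\ factors_through iota rho, galois_lift iota lift, place v,
        vge v 1 (p%:R : K)
      & m%:R = \sum_(k \in [set: nat]) codim k]].

Definition artin_conductor (R : realType) n (rho : artin_rep R n) : nat :=
  \big[muln/1%N]_(p \in [set p | prime p]) (p ^ artin_cond_exp rho p)%N.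

Section EllipticConductor.
Variable E : weierstrass rat.

Definition min_model_at (p : nat) (v : rat -> int) (W : weierstrass rat) :=
  [/\ place v, vge v 1 (p%:R : rat), minimal_at v W
    & exists u r s t, u != 0 /\ W = wchange u r s t E].

Definition good_red (p : nat) :=
  exists v W, min_model_at p v W /\ v (disc W) = 0.

Definition mult_red (p : nat) :=
  exists v W, [/\ min_model_at p v W, vge v 1 (disc W) & ~ vge v 1 (c4 W)].

Definition tame_exp (p : nat) : nat :=
  if `[< good_red p >] then 0%N else if `[< mult_red p >] then 1%N else 2%N.

(* Tame part plus wild part; the latter is computed from the action of the
   higher ramification groups on E[l] for some prime l <> p, over a Galois
   field K containing the coordinates of E[l]. *)
Definition ell_cond_exp (p : nat) : nat := xget 0%N [set m |
  exists l (K : splittingFieldType rat) v,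
    let G k := ramif_group v k in let El := n_torsion (wbase E K) l in
    let fixed k := [set P | El P /\ forall g, g \in G k -> pmap g P = P] in
    let wild k : rat := #|G k|%:R / #|G 0%N|%:R *
                        (2 - (logn l (quot_card (fixed k) eq))%:R) in
    [/\ prime l /\ l != p, quot_card El eq = (l ^ 2)%N, place v,
        vge v 1 (p%:R : K)
      & (m%:R : rat) = (tame_exp p)%:R
          + \sum_(k \in [set k : nat | (0 < k)%N]) wild k]].

Definition ell_conductor : nat :=
  \big[muln/1%N]_(p \in [set p | prime p]) (p ^ ell_cond_exp p)%N.

Definition semistable := forall p, prime p -> good_red p \/ mult_red p.

Definition bieval (f : {poly {poly rat}}) (x y : algC) : algC :=
  ((map_poly (map_poly ratr) f).[y%:P]).[x].

(* A homomorphism of Q-bar-points which away from finitely many points is given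
   by rational functions with coefficients in rat. *)
Definition isogeny (E' : weierstrass rat) (phi : point algC -> point algC) :=
  let EC := wbase E algC in let EC' := wbase E' algC in
  [/\ elliptic E',
      forall P, on_curve EC P -> on_curve EC' (phi P),
      forall P Q, on_curve EC P -> on_curve EC Q ->
        phi (padd EC P Q) = padd EC' (phi P) (phi Q)
    & exists (f1 g1 f2 g2 : {poly {poly rat}}) (l : seq (point algC)),
        forall x y, on_curve EC (Some (x, y)) -> Some (x, y) \notin l ->
          [/\ bieval g1 x y != 0, bieval g2 x y != 0
            & phi (Some (x, y)) = Some (bieval f1 x y / bieval g1 x y,
                                        bieval f2 x y / bieval g2 x y)]].

(* Every isogeny from E is, up to isomorphism, multiplication by an integer. *)
Definition no_nontrivial_isogeny :=
  forall E' phi, isogeny E' phi ->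
    exists2 n, (0 < n)%N & forall P, on_curve (wbase E algC) P ->
      (phi P = None <-> pmuln (wbase E algC) n P = None).

End EllipticConductor.

(* Om is an algebraic closure of Q_p, with normalised absolute value nrm. *)
Definition padic_closure (R : realType) (p : nat) (Om : closedFieldType)
    (nrm : Om -> R) :=
  completed_closure nrm (fun x : rat => ratr x : Om) /\ nrm p%:R = p%:R^-1.

Section LocalRootNumbers.
Variables (R : realType) (p : nat) (Om : closedFieldType) (nrm : Om -> R).
Local Notation C := R[i].
Local Notation Aut := {rmorphism Om -> Om}.
Implicit Types (L M : set Om) (s t u : Aut).

Definition Qp : set Om := adherence nrm (fun x : rat => ratr x : Om).

Definition local_field L :=
  [/\ Qp `<=` L,
      forall x y, L x -> L y -> L (x - y) /\ L (x * y),
      forall x, L x -> L x^-1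
    & exists n (b : 'I_n -> Om), (forall k, L (b k)) /\
        forall x, L x -> exists2 c : 'I_n -> Om, (forall k, Qp (c k)) &
          x = \sum_k c k * b k].

Definition uniformizer L (pi : Om) :=
  [/\ L pi, pi != 0, nrm pi < 1
    & forall x, L x -> nrm x < 1 -> nrm x <= nrm pi].

Definition local_residue_card L : nat :=
  quot_card [set x | L x /\ nrm x <= 1] (fun x y => nrm (x - y) < 1).

Definition fixes_local L s := forall x, L x -> s x = x.

(* s lies in the Weil group of L and induces the d-th power of the arithmetic
   Frobenius on the residue field of Om. *)
Definition weil L s (d : int) :=
  let q := local_residue_card L in
  fixes_local L s /\
  exists m k : nat, d = m%:Z - k%:Z /\
    forall x, nrm x <= 1 -> nrm (s x ^+ (q ^ k) - x ^+ (q ^ m)) < 1.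

Definition in_weil L s := exists d, weil L s d.

(* Representatives of the Weil group of L modulo that of M, equivalently of the
   L-embeddings of M in Om. *)
Definition embeddings L M d (e : 'I_d -> Aut) :=
  [/\ forall k, in_weil L (e k),
      forall k l, (forall x, M x -> e k x = e l x) -> k = l
    & forall s, fixes_local L s ->
        exists k, forall x, M x -> s x = e k x].

Definition weil_rep L n (r : Aut -> 'M[C]_n) :=
  [/\ forall s, in_weil L s -> r s \in unitmx,
      forall s t u : Aut, in_weil L s -> in_weil L t -> u =1 s \o t ->
        r u = r s *m r t
    & exists l : seq Om, forall s : Aut, weil L s 0 -> {in l, s =1 id} ->
        r s = 1%:M].

(* Mackey's formula for the character induced from the Weil group of M. *)
Definition induced L M (f g : Aut -> C) :=
  exists d (e : 'I_d -> Aut), embeddings L M e /\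
    forall s, in_weil L s ->
      g s = \sum_k xget 0 [set z |
              exists h, [/\ in_weil M h, s \o e k =1 e k \o h & z = f h]].

Definition abelian_ext L M :=
  [/\ local_field M, L `<=` M,
      forall s x, fixes_local L s -> M x -> M (s x)
    & forall s t x, fixes_local L s -> fixes_local L t -> M x ->
        s (t x) = t (s x)].

(* Local reciprocity, with uniformizers going to arithmetic Frobenius; art is
   determined up to automorphisms trivial on the maximal abelian extension. *)
Definition artin_map L (art : Om -> Aut) :=
  [/\ forall x, L x -> x != 0 -> exists pi d,
        [/\ uniformizer L pi, nrm x = nrm pi ^ d & weil L (art x) d],
      forall M x y z, abelian_ext L M -> L x -> x != 0 -> L y -> y != 0 ->
        M z -> art (x * y) z = art x (art y z)
    & forall M d (e : 'I_d -> Aut) y z, abelian_ext L M -> embeddings L M e ->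
        M y -> y != 0 -> M z -> art (\prod_k e k y) z = z].

Definition cis (x : R) : C := Complex (cos x) (sin x).

(* The additive character x |-> exp(-2 i pi {x}) of Q_p, and its composite with
   the trace of L over Q_p. *)
Definition psi (x : Om) : C := xget 1 [set z |
  exists (m : int) (k : nat), nrm (x - m%:~R / p%:R ^+ k) <= 1 /\
    z = cis (- (2 * pi * (m%:~R / p%:R ^+ k)))].

Definition psi_tr L (x : Om) : C := xget 1 [set z |
  exists d (e : 'I_d -> Aut), embeddings Qp L e /\ z = psi (\sum_k e k x)].

(* U_L^(n); nu is a uniformizer of L. *)
Definition unit_group L (nu : Om) (n : nat) : set Om :=
  [set x | [/\ L x, nrm x = 1 & nrm (x - 1) <= nrm nu ^+ n]].

(* z is Tate's local constant of the quasi-character w of L^* for psi_tr L,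
   divided by its absolute value: a is the conductor exponent of w, n the
   largest integer with psi_tr L trivial on nu^-n O_L, and the valuation of c is
   a + n.  For a = 0 the sum has one term and equals w c. *)
Definition tate_root L (w : Om -> C) (z : C) :=
  exists nu (a n : nat) c m (x : 'I_m -> Om),
    [/\ uniformizer L nu,
        (forall y, unit_group L nu a y -> w y = 1) /\
        (forall b, (b < a)%N -> exists2 y, unit_group L nu b y & w y != 1),
        (forall y, L y -> nrm y <= nrm nu ^- n -> psi_tr L y = 1) /\
        (exists y, [/\ L y, nrm y <= nrm nu ^- n.+1 & psi_tr L y != 1]),
        [/\ L c, nrm c = nrm nu ^+ (a + n)
          & [/\ forall k, L (x k) /\ nrm (x k) = 1,
                forall k l, nrm (x k - x l) <= nrm nu ^+ a -> k = l
              & forall y, L y -> nrm y = 1 ->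
                  exists k, nrm (y - x k) <= nrm nu ^+ a]]
      & let S := \sum_k (w (x k / c))^-1 * psi_tr L (x k / c) in z = S / `|S|].

(* Langlands-Deligne: W L f is the root number, for the additive character
   psi_tr L, of the representation of the Weil group of L with character f.  It
   is determined by additivity, inductivity in degree 0 (phrased with two
   representations of equal dimension) and Tate's formula in dimension 1. *)
Definition root_number_theory (W : set Om -> (Aut -> C) -> C) :=
  [/\ forall L f g, local_field L -> (forall s, in_weil L s -> f s = g s) ->
        W L f = W L g,
      forall L n m (r : Aut -> 'M[C]_n) (r' : Aut -> 'M[C]_m),
        local_field L -> weil_rep L r -> weil_rep L r' ->
        W L (fun s => \tr (r s) + \tr (r' s)) =
        W L (fun s => \tr (r s)) * W L (fun s => \tr (r' s)),
      forall L M n (r r' : Aut -> 'M[C]_n) (g g' : Aut -> C),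
        local_field L -> local_field M -> L `<=` M ->
        weil_rep M r -> weil_rep M r' ->
        induced L M (fun s => \tr (r s)) g ->
        induced L M (fun s => \tr (r' s)) g' ->
        W L g * W M (fun s => \tr (r' s)) = W L g' * W M (fun s => \tr (r s))
    & forall L (r : Aut -> 'M[C]_1) art z,
        local_field L -> weil_rep L r -> artin_map L art ->
        tate_root L (fun x => r (art x) 0 0) z -> W L (fun s => \tr (r s)) = z].

Variable emb : {rmorphism algC -> Om}.

Definition restricts s (t : absgal) := emb \o t =1 s \o emb.

Variable E : weierstrass rat.

(* x is the trace of s on the rational l-adic Tate module of E for the primes
   l <> p: it lies in Z[1/p] and is congruent, modulo every l^k, to the trace of
   s on E[l^k] in any basis (P, Q). *)
Definition tate_trace s (x : rat) :=
  exists (N : nat) (y : int), x = y%:~R / p%:R ^+ N /\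
  forall (l k : nat) (P Q : point Om) (a b c d : int),
    let EO := wbase E Om in let El := n_torsion EO (l ^ k) in
    prime l -> l != p -> El P -> El Q ->
    (forall T, El T -> exists m n,
       T = padd EO (pmulz EO m P) (pmulz EO n Q)) ->
    pmap s P = padd EO (pmulz EO a P) (pmulz EO c Q) ->
    pmap s Q = padd EO (pmulz EO b P) (pmulz EO d Q) ->
    (y = p%:Z ^+ N * (a + d) %[mod (l ^ k)%:Z])%Z.

Variables (n : nat) (rho : artin_rep R n).

(* f is the character of the twist of E by rho on the Weil group of Q_p. *)
Definition twist_character (f : Aut -> C) :=
  forall s (t : absgal) x, in_weil Qp s -> restricts s t -> tate_trace s x ->
    f s = ratr x * \tr (rho t).

(* Potentially multiplicative case: V = V_l(E) (x) rho with monodromy N, and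
   V / ker N = eta (x) rho, where eta is the character of order at most 2 with
   trace eta(s) (1 + p^d) on V_l(E) for s of degree d.  The contribution of N is
   det(-Frob) on the inertia invariants of V / ker N, made of absolute value 1;
   B is a basis of these invariants. *)
Definition monodromy_factor (z : C) :=
  exists (T : Aut -> 'M[C]_n) m (B : 'M[C]_(n, m)) (A : 'M[C]_m) phi,
    [/\ forall s d (t : absgal) x, weil Qp s d -> restricts s t -> tate_trace s x ->
          T s = (ratr x / (1 + p%:R ^ d)) *: rho t,
        \rank B = m /\ (forall s, weil Qp s 0 -> T s *m B = B),
        (forall b : 'cV[C]_n, (forall s, weil Qp s 0 -> T s *m b = b) ->
           exists c : 'cV[C]_m, b = B *m c),
        weil Qp phi 1 /\ T phi *m B = B *m A
      & z = \det (- A) / `|\det (- A)|].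

End LocalRootNumbers.

Section GlobalRootNumbers.
Variables (R : realType) (n : nat) (rho : artin_rep R n).
Local Notation C := R[i].

Definition artin_local_root (p : nat) : C := xget 0 [set z |
  exists (Om : closedFieldType) (nrm : Om -> R) (emb : {rmorphism algC -> Om})
         W (f : {rmorphism Om -> Om} -> C),
    [/\ padic_closure p nrm, root_number_theory p nrm W,
        forall s (t : absgal), in_weil nrm (Qp nrm) s -> restricts emb s t ->
          f s = \tr (rho t)
      & z = W (Qp nrm) f]].

(* The infinite place contributes i per eigenvalue -1 of complex conjugation. *)
Definition artin_root_number : C :=
  'i ^+ \rank (rho (Num.conj : absgal) - 1%:M) *
  \big[*%R/1]_(p \in [set p | prime p]) artin_local_root p.

Variable E : weierstrass rat.

Definition twist_local_root (p : nat) : C := xget 0 [set z |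
  exists (Om : closedFieldType) (nrm : Om -> R) (emb : {rmorphism algC -> Om})
         W (f : {rmorphism Om -> Om} -> C) (delta : C),
    [/\ padic_closure p nrm, root_number_theory p nrm W,
        twist_character p nrm emb E rho f,
        if 1 < nrm (ratr (jinv E)) then monodromy_factor p nrm emb E rho delta
        else delta = 1
      & z = W (Qp nrm) f * delta]].

Definition twist_root_number : C :=
  (-1) ^+ n *
  \big[*%R/1]_(p \in [set p | prime p]) twist_local_root p.

End GlobalRootNumbers.

Section Characters.
Variable R : realType.
Local Notation C := R[i].

Definition subfield_set (S : set C) :=
  [/\ S 1, forall x y, S x -> S y -> S (x - y) /\ S (x * y)
    & forall x, S x -> S x^-1].

Definition char_field n (rho : artin_rep R n) : set C := [set x |
  forall S, subfield_set S -> (forall s, S (\tr (rho s))) -> S x].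

(* Automorphisms of S over the rationals; g is irrelevant outside S. *)
Definition field_aut (S : set C) (g : C -> C) :=
  [/\ g 1 = 1,
      forall x y, S x -> S y -> g (x + y) = g x + g y /\ g (x * y) = g x * g y,
      forall x, S x -> S (g x)
    & forall y, S y -> exists2 x, S x & g x = y].

Definition primitive_dirichlet (N : nat) (chi : nat -> C) :=
  [/\ (0 < N)%N,
      forall a, (chi a != 0) = coprime a N,
      forall a b, (a = b %[mod N])%N -> chi a = chi b,
      forall a b, chi (a * b)%N = chi a * chi b
    & forall M, (M %| N)%N -> (M < N)%N ->
        exists a, [/\ coprime a N, (a = 1 %[mod M])%N & chi a != 1]].

Definition dirichlet_order (N : nat) (chi : nat -> C) (d : nat) :=
  [/\ (0 < d)%N, forall a, coprime a N -> chi a ^+ d = 1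
    & forall k, (0 < k)%N -> (forall a, coprime a N -> chi a ^+ k = 1) ->
        (d <= k)%N].

Definition is_dirichlet (N : nat) (chi : nat -> C) (rho : artin_rep R 1) :=
  forall (s : absgal) (a : nat) (z : algC),
    N.-primitive_root z -> s z = z ^+ a -> rho s 0 0 = chi a.

Definition in_Z_zeta (d : nat) (x : C) :=
  exists (z : C) (f : {poly int}),
    d.-primitive_root z /\ x = (map_poly (fun k : int => k%:~R) f).[z].

End Characters.

Section Properties.
Variables (R : realType) (E : weierstrass rat).
Local Notation C := R[i].
Variable B : forall n, artin_rep R n -> C.

Definition C1 := forall F : fieldExtType rat,
  sha_finite R E F /\
  forall n (rho : artin_rep R n), is_ind_triv F rho ->
    (BSD R E F)%:C%C = B rho.

Definition C2 := forall n m (rho : artin_rep R n) (tau : artin_rep R m),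
  B (asum rho tau) = B rho * B tau.

Definition C3 := forall (K : splittingFieldType rat)
    (iota : {rmorphism K -> algC}) n (rho : artin_rep R n) r,
  factors_through iota rho -> mw_mult iota E rho r ->
  B rho = B (adual rho) * (-1) ^+ r * twist_root_number rho E
          * artin_root_number rho ^- 2.

Definition C4 := forall n (rho : artin_rep R n), aiso rho (adual rho) ->
  B rho \is Num.real /\ Num.sg (B rho) = Num.sg (artin_root_number rho).

Definition C5 := forall (K : splittingFieldType rat)
    (iota : {rmorphism K -> algC}) n (rho : artin_rep R n),
  factors_through iota rho -> mw_mult iota E rho 0 ->
  [/\ char_field rho (B rho), B rho != 0
    & forall g (rho' : artin_rep R n), field_aut (char_field rho) g ->
        (forall s, \tr (rho' s) = g (\tr (rho s))) -> B rho' = g (B rho)].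

Definition C6 := forall (K : splittingFieldType rat)
    (iota : {rmorphism K -> algC}) (rho : artin_rep R 1) N chi d,
  factors_through iota rho -> mw_mult iota E rho 0 ->
  primitive_dirichlet N chi -> is_dirichlet N chi rho ->
  dirichlet_order N chi d -> (1 < d)%N ->
  coprime (ell_conductor E) (artin_conductor rho) \/
    (semistable E /\ no_nontrivial_isogeny E) ->
  in_Z_zeta d (B rho).

End Properties.

(* B is a function of the isomorphism class of the representation. *)
Definition conjecture_C (R : realType) :=
  forall E : weierstrass rat, elliptic E ->
  exists B : forall n, artin_rep R n -> R[i],
    [/\ forall n (rho : artin_rep R n), B n rho != 0,
        forall n (rho tau : artin_rep R n), aiso rho tau -> B n rho = B n tau
      & [/\ C1 E B, C2 B, C3 E B, C4 B & C5 E B /\ C6 E B]].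

(* m = 1 in Z/nZ, for m with numerator and denominator prime to n. *)
Definition rat_eq1_mod (m : rat) (n : nat) :=
  [/\ coprimez (numq m) n, coprimez (denq m) n
    & (numq m = denq m %[mod n%:Z])%Z].

Definition rth_power_mod (r a q : nat) :=
  exists x : nat, (x ^ r = a %[mod q])%N.

(* Main.v *)
(* Let n = q1 q2 and K = Q(zeta_n).  The permutation representations attached to
   F^{C_r}, F^{C_q1 x| C_r}, F^{C_q2 x| C_r} and Q decompose, by Fourier analysis
   on C_n, into the representations rho_j induced from the characters zeta_n^j of
   C_n; in the quotient of the theorem everything cancels except the product of
   BSD(E, rho_j) over a system of representatives J of the units mod n modulo the
   action of C_r.  By (C5) there is y in K with BSD(E, rho_j) = sigma_j(y), so the
   quotient is X = prod_(j in J) sigma_j(y), a rational number.  Since r^2 does not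
   divide q2 - 1, one may take J = (Z/q1)^* x T with T the r-th powers mod q2, and
   q1 T = T by hypothesis.  Let e be a prime of K above q1 and expand y with respect
   to the uniformizer 1 - zeta_q1: (Z/q1)^* is inertia and q1 in T is a Frobenius,
   which forces X = q1^a u with u = 1 mod q1 and q1^a = 1 mod q2.  Exchanging q1 and
   q2 gives X = q2^b u' likewise, whence X / (q1^a q2^b) = 1 mod q1 q2. *)
Require Import Defs.
From HB Require Import structures.
From mathcomp Require Import all_boot all_order all_algebra all_fingroup.
From mathcomp Require Import all_solvable all_field.
From mathcomp Require Import complex.
From mathcomp Require Import all_classical all_reals all_analysis.
From mathcomp Require Import ring zify.
Set Implicit Arguments.
Unset Strict Implicit.
Unset Printing Implicit Defensive.
Import Order.TTheory GRing.Theory Num.Theory.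
Local Open Scope ring_scope.

(** * Evaluation of integer polynomials at roots of unity *)

(** No ring of integers and no valuation is constructed. With {p, q} = {q1, q2}, elements of K are
    polynomials evaluated at a primitive pq-th root of unity z; reduction above p evaluates the same
    integer polynomial at a primitive q-th root of unity e in characteristic p; [expansion] records
    exponent and leading coefficient with respect to 1 - z^q.

    Why the congruences are forced: let k_b, c_b be these data for the conjugate of y with residues
    1 mod p and b mod q. Inertia at a multiplies the leading coefficient by a^(k_b), so the product
    over a has coefficient c_b^(p-1) times (p-1)! to the power k_b. Since p has exponent p-1 and
    coefficient (p-1)!, comparing X with p^s m/d gives s = sum of the k_b, the factorials cancel,
    and m/d reduces to C^(p-1) with C the product of the c_b. Frobenius gives k_(pb) = k_b and
    c_(pb) = c_b^p. As pT = T, C^p = C, so m/d = 1 mod p; and reindexing the product of the b^(k_b)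
    by b -> pb multiplies it by p^s, so p^s = 1 mod q. *)

Definition zev (A : comNzRingType) (x : A) (s : {poly int}) : A :=
  (map_poly intr s).[x].

Section IntegerPolynomials.
Variables (A : comNzRingType) (x : A).

Lemma zevM s t : zev x (s * t) = zev x s * zev x t.
Proof. by rewrite /zev rmorphM hornerM. Qed.

Lemma zevB s t : zev x (s - t) = zev x s - zev x t.
Proof. by rewrite /zev rmorphB hornerD hornerN. Qed.

Lemma zev1 : zev x 1 = 1.
Proof. by rewrite /zev rmorph1 hornerC. Qed.

Lemma zevC (c : int) : zev x c%:P = c%:~R.
Proof. by rewrite /zev map_polyC hornerC. Qed.

Lemma zevXn k : zev x 'X^k = x ^+ k.
Proof. by rewrite /zev map_polyXn hornerXn. Qed.

Lemma zevX s k : zev x (s ^+ k) = zev x s ^+ k.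
Proof. by rewrite /zev rmorphXn horner_exp. Qed.

Lemma zev_prod (I : Type) (l : seq I) (P : pred I) (s : I -> {poly int}) :
  zev x (\prod_(i <- l | P i) s i) = \prod_(i <- l | P i) zev x (s i).
Proof. by rewrite /zev rmorph_prod horner_prod. Qed.

Lemma zev_sum (I : Type) (l : seq I) (P : pred I) (s : I -> {poly int}) :
  zev x (\sum_(i <- l | P i) s i) = \sum_(i <- l | P i) zev x (s i).
Proof. by rewrite /zev rmorph_sum horner_sum. Qed.

Lemma zev_comp s k : zev x (s \Po 'X^k) = zev (x ^+ k) s.
Proof. by rewrite /zev map_comp_poly map_polyXn horner_comp hornerXn. Qed.

End IntegerPolynomials.

Lemma zev_morph (A B : comNzRingType) (f : {rmorphism A -> B}) x s :
  f (zev x s) = zev (f x) s.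
Proof.
rewrite /zev -horner_map -map_poly_comp; congr (_.[_]).
by apply: eq_map_poly => c /=; rewrite rmorph_int.
Qed.

Lemma horner_ratr_intr (C : numFieldType) (x : C) (s : {poly int}) :
  (map_poly ratr (map_poly intr s : {poly rat})).[x] = zev x s.
Proof.
rewrite -map_poly_comp; congr (_.[_]).
by apply: eq_map_poly => c /=; rewrite ratr_int.
Qed.

Lemma zev_Frobenius (K : comNzRingType) p (chK : p \in [pchar K]) (x : K) s :
  zev (x ^+ p) s = zev x s ^+ p.
Proof. by rewrite -!(pFrobenius_autE chK) zev_morph. Qed.

(** This is irreducibility over the rationals, imported from [algC]: a common root there is a
    primitive n-th root of unity, whose minimal polynomial ['Phi_n] would then divide s. *)
Lemma Cyclotomic_coprime n (s : {poly rat}) : (0 < n)%N ->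
  ~~ (map_poly intr 'Phi_n %| s) -> coprimep (map_poly intr 'Phi_n) s.
Proof.
move=> n0; set Phi := map_poly intr 'Phi_n => Phi_s.
have PhiE (w : algC) : root (map_poly ratr Phi) w = n.-primitive_root w.
  have [w0 w0P] := C_prim_root_exists n0.
  rewrite -(root_cyclotomic w0P) -(Cintr_Cyclotomic w0P) -map_poly_comp.
  by congr root; apply: eq_map_poly => c /=; rewrite ratr_int.
apply: contraR Phi_s; rewrite coprimep_def.
rewrite -(size_map_poly (ratr : {rmorphism rat -> algC})) => /closed_rootP[w].
rewrite gcdp_map root_gcd PhiE => /andP[w_prim sw].
have [q [qE q_monic q_min]] := minCpolyP w.
have -> : Phi = q.
  apply: (map_poly_inj (ratr : {rmorphism rat -> algC})); rewrite -qE.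
  rewrite (minCpoly_cyclotomic w_prim) -(Cintr_Cyclotomic w_prim) -map_poly_comp.
  by apply: eq_map_poly => c /=; rewrite ratr_int.
by rewrite -q_min.
Qed.

Section CyclotomicRoot.
Variables (C : numFieldType) (n : nat) (z : C).
Hypothesis z_prim : n.-primitive_root z.

Lemma zev_Cyclotomic : zev z 'Phi_n = 0.
Proof.
have n0 := prim_order_gt0 z_prim.
have: zev z ('X^n - 1) == 0 by rewrite zevB zevXn zev1 prim_expr_order // subrr.
rewrite -prod_Cyclotomic // zev_prod prodf_seq_eq0 => /hasP[d].
rewrite -dvdn_divisors // => dn /andP[_ /eqP Pd].
suff: (n %| d)%N by move=> nd; have/eqP<- : d == n by rewrite eqn_dvd dn nd.
have d0 : (0 < d)%N by rewrite (dvdn_gt0 n0).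
rewrite (prim_order_dvd z_prim) -subr_eq0 -(zevXn z) -(zev1 z) -zevB.
rewrite -prod_Cyclotomic // zev_prod prodf_seq_eq0; apply/hasP; exists d.
  by rewrite -dvdn_divisors.
by rewrite Pd eqxx.
Qed.

Lemma Cyclotomic_dvd (s : {poly rat}) :
  (map_poly ratr s).[z] = 0 -> map_poly intr 'Phi_n %| s.
Proof.
move=> sz; apply: contraT => /(Cyclotomic_coprime (prim_order_gt0 z_prim)).
rewrite -(coprimep_map (ratr : {rmorphism rat -> C})) => cop.
suff /(coprimep_root cop) : root (map_poly ratr (map_poly intr 'Phi_n : {poly rat})) z.
  by rewrite sz eqxx.
by rewrite rootE horner_ratr_intr zev_Cyclotomic.
Qed.

(** ['Phi_n] is monic, so the division stays over the integers, and the remainder vanishes by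
    irreducibility over the rationals. The quotient has to be integral because it will be evaluated
    in characteristic p. *)
Lemma zev_eq0 (s : {poly int}) : zev z s = 0 -> exists t, s = t * 'Phi_n.
Proof.
move=> s0; have Pm := Cyclotomic_monic n.
exists (Pdiv.Ring.rdivp s 'Phi_n).
have sE := Pdiv.RingMonic.rdivp_eq Pm s.
set t := Pdiv.Ring.rmodp s 'Phi_n in sE.
have t0 : zev z t = 0.
  move: s0; rewrite sE /zev rmorphD rmorphM /= hornerD hornerM.
  by rewrite -/(zev z 'Phi_n) zev_Cyclotomic mulr0 add0r.
suff t_eq0 : t = 0 by rewrite {1}sE t_eq0 addr0.
have /Cyclotomic_dvd/dvdp_leq : (map_poly ratr (map_poly intr t : {poly rat})).[z] = 0.
  by rewrite horner_ratr_intr.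
rewrite -size_poly_eq0 !size_map_inj_poly ?size_poly_eq0 //; try exact: intr_inj.
have t_lt : (size t < size 'Phi_n)%N.
  by rewrite Pdiv.Ring.ltn_rmodp // monic_neq0.
by rewrite leqNgt t_lt; case: eqP => // _ /(_ isT).
Qed.

(** Bezout against ['Phi_n] over the rationals, with denominators cleared into N. The integer N
    later bounds how often the uniformizer can be divided out of s. *)
Lemma zev_inv (s : {poly int}) : zev z s != 0 ->
  exists u (N : int), N != 0 /\ zev z (u * s) = N%:~R.
Proof.
move=> s0; set Phi : {poly rat} := map_poly intr 'Phi_n.
have : coprimep Phi (map_poly intr s).
  apply: (Cyclotomic_coprime (prim_order_gt0 z_prim)).
  apply: contraNN s0 => /dvdpP[t tE].
  by rewrite -horner_ratr_intr tE rmorphM /= hornerM horner_ratr_intr zev_Cyclotomic mulr0.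
case/Bezout_eq1_coprimepP => -[v u] /= uv1.
have [u' [N N0 uE]] := rat_poly_scale u; exists u', N; split=> //.
have := congr1 (fun t => (map_poly ratr t).[z]) uv1.
rewrite rmorphD !rmorphM /= hornerD !hornerM !horner_ratr_intr zev_Cyclotomic mulr0 add0r.
rewrite rmorph1 hornerC uE linearZ /= hornerZ horner_ratr_intr fmorphV /= ratr_int.
move/(congr1 ( *%R N%:~R)); rewrite mulr1 -mulrA mulVKf ?intr_eq0 //.
by rewrite zevM.
Qed.

End CyclotomicRoot.

Lemma Galois_conjugate (C : numFieldType) n (z : C) (f : {poly rat}) j :
  n.-primitive_root z -> coprime j n ->
  (map_poly ratr f).[z] = 0 -> (map_poly ratr f).[z ^+ j] = 0.
Proof.
move=> z_prim jn /(Cyclotomic_dvd z_prim)/dvdpP[g ->]; rewrite rmorphM /= hornerM.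
have zj : n.-primitive_root (z ^+ j) by rewrite prim_root_exp_coprime.
by rewrite horner_ratr_intr (zev_Cyclotomic zj) mulr0.
Qed.

(** * Reduction modulo a prime above p *)

Lemma divisors_prime p : prime p -> perm_eq (divisors p) [:: 1; p]%N.
Proof.
move=> p_pr; apply: uniq_perm; rewrite ?divisors_uniq //=.
  by rewrite inE andbT neq_ltn prime_gt1.
move=> d; rewrite -dvdn_divisors ?prime_gt0 // !inE.
have [_ p_div] := primeP p_pr; apply/idP/orP => [/p_div/orP //|].
by case=> /eqP ->.
Qed.

Lemma divisors_prime2 p q : prime p -> prime q -> p != q ->
  perm_eq (divisors (p * q)) [:: 1; p; q; p * q]%N.
Proof.
move=> p_pr q_pr pq; have [p1 q1] := (prime_gt1 p_pr, prime_gt1 q_pr).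
have [p0 q0] := (ltnW p1, ltnW q1).
apply: uniq_perm; rewrite ?divisors_uniq //=.
  rewrite !inE; have [/ltn_eqF-> /ltn_eqF->] := (ltn_Pmulr q1 p0, ltn_Pmull p1 q0).
  have /ltn_eqF-> : (1 < p * q)%N by rewrite (leq_trans p1) // leq_pmulr.
  by rewrite (ltn_eqF p1) (ltn_eqF q1) (negPf pq).
move=> d; rewrite -dvdn_divisors ?muln_gt0 ?p0 // !inE.
apply/idP/idP => [|/or4P[]/eqP-> //]; try exact: dvdn_mulr; try exact: dvdn_mull.
have dvd_pr u v : prime v -> (u %| v)%N -> (u == 1)%N || (u == v).
  by case/primeP=> _; apply.
case: (boolP (p %| d)%N) => [/dvdnP[d' ->]|].
  rewrite (mulnC d') dvdn_pmul2l // => /(dvd_pr _ _ q_pr) /orP[]/eqP->.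
    by rewrite muln1 eqxx orbT.
  by rewrite eqxx !orbT.
rewrite -prime_coprime // => pd; rewrite Gauss_dvdr ?(coprime_sym d) //.
by case/(dvd_pr _ _ q_pr)/orP=> ->; rewrite ?orbT.
Qed.

Section PrimeAbove.
Variables (C : numFieldType) (p q : nat) (z : C).
Variables (K : fieldType) (Fp_K : {rmorphism 'F_p -> K}) (e : K).
Hypotheses (p_pr : prime p) (q_pr : prime q) (pq : p != q).
Hypotheses (z_prim : (p * q).-primitive_root z) (e_prim : q.-primitive_root e).

Lemma pchar_residue : p \in [pchar K].
Proof. by rewrite (rmorph_pchar Fp_K) // pchar_Fp. Qed.

Lemma residue_int_eq0 (c : int) : (c%:~R == 0 :> K) = (p %| `|c|)%N.
Proof.
by case: c => c; rewrite ?NegzE /= ?mulrNz ?oppr_eq0 ?absz_nat -(dvdn_pcharf pchar_residue).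
Qed.

Lemma residue_expr_neq1 : e ^+ p != 1.
Proof.
rewrite -(prim_order_dvd e_prim) dvdn_prime2 // eq_sym.
exact: pq.
Qed.

(** In characteristic p one has X^(pq) - 1 = (X^q - 1)^p, so the factorisation into cyclotomic
    polynomials yields (X^p - 1) Phi_pq = (X - 1)(X^q - 1)^(p-1). At e the right side vanishes while
    e^p - 1 does not. *)
Lemma zev_residue_Cyclotomic : zev e 'Phi_(p * q) = 0.
Proof.
have [p0 q0] := (prime_gt0 p_pr, prime_gt0 q_pr).
pose X k : {poly K} := map_poly intr ('X^k - 1).
have XE k : X k = 'X^k - 1 by rewrite /X rmorphB rmorph1 /= map_polyXn.
have eqX : X p * X q * map_poly intr 'Phi_(p * q) = X 1%N * X q ^+ p.
  have -> : X q ^+ p = X (p * q)%N.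
    have chX : p \in [pchar {poly K}] by rewrite (rmorph_pchar polyC) // pchar_residue.
    rewrite !XE -!(pFrobenius_autE chX) rmorphB rmorph1 /= pFrobenius_autE.
    by rewrite -exprM mulnC.
  rewrite /X -!rmorphM /=; congr map_poly.
  rewrite -!prod_Cyclotomic ?muln_gt0 ?p0 //.
  rewrite (perm_big _ (divisors_prime p_pr)) (perm_big _ (divisors_prime q_pr)) /=.
  rewrite (perm_big _ (divisors_prime2 p_pr q_pr pq)) /=.
    have -> : divisors 1 = [:: 1%N] by [].
  rewrite !big_cons !big_nil; ring.
have Xq0 : X q != 0 by rewrite XE monic_neq0 // monicXnsubC.
have {}eqX : X p * map_poly intr 'Phi_(p * q) = X 1%N * X q ^+ p.-1.
  apply: (mulIf Xq0); rewrite mulrAC eqX -{1}(prednK p0) exprS.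
  by rewrite mulrCA mulrC.
have /eqP := congr1 (horner^~ e) eqX.
rewrite !hornerM horner_exp !XE !hornerE (prim_expr_order e_prim).
rewrite subrr expr0n -subn1 subn_eq0 leqNgt prime_gt1 // mulr0.
by rewrite mulf_eq0 subr_eq0 (negPf residue_expr_neq1) => /eqP.
Qed.

(* Hence evaluation at e is a well-defined homomorphism Z[z] -> K, the reduction
   modulo a prime above p. *)
Lemma zev_residue_eq0 (s : {poly int}) : zev z s = 0 -> zev e s = 0.
Proof. by case/(zev_eq0 z_prim)=> t ->; rewrite zevM zev_residue_Cyclotomic mulr0. Qed.

Lemma zev_residue_neq0 (s : {poly int}) : zev e s != 0 -> zev z s != 0.
Proof. by apply: contra => /eqP/zev_residue_eq0->. Qed.

Local Notation lam := (1 - z ^+ q).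

Lemma uniformizer_neq0 : lam != 0.
Proof.
rewrite subr_eq0 eq_sym -(prim_order_dvd z_prim); apply/negP => /dvdn_leq.
by rewrite prime_gt0 // leqNgt ltn_Pmull ?prime_gt1 ?prime_gt0 // => /(_ isT).
Qed.

Lemma zev_uniformizer (A : comNzRingType) (x : A) : zev x (1 - 'X^q) = 1 - x ^+ q.
Proof. by rewrite zevB zev1 zevXn. Qed.

(* y = lam^k u for a unit u of the localisation of Z[z], with reduction c. *)
Definition expansion (y : C) (k : int) (c : K) := exists s t : {poly int},
  [/\ zev e s != 0, zev e t != 0, y * zev z t = lam ^ k * zev z s
    & c = zev e s / zev e t].

Lemma expansion_unit (s : {poly int}) : zev e s != 0 ->
  expansion (zev z s) 0 (zev e s).
Proof.
move=> s0; exists s, 1; rewrite !zev1 oner_neq0 expr0z mulr1 mul1r invr1 mulr1.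
by split.
Qed.

Lemma expansion_uniformizer : expansion lam 1 1.
Proof. by exists 1, 1; rewrite !zev1 oner_neq0 expr1z divr1 mulr1; split. Qed.

Lemma expansionM y y' k k' c c' : expansion y k c -> expansion y' k' c' ->
  expansion (y * y') (k + k') (c * c').
Proof.
case=> [s [t [s0 t0 yE ->]]] [s' [t' [s0' t0' yE' ->]]].
exists (s * s'), (t * t'); rewrite !zevM !mulf_neq0 //; split=> //.
  by rewrite mulrACA yE yE' mulrACA expfzDr ?uniformizer_neq0.
by rewrite mulrACA invfM.
Qed.

Lemma expansionV y k c : expansion y k c -> expansion y^-1 (- k) c^-1.
Proof.
case=> [s [t [s0 t0 yE ->]]]; exists t, s; split=> //; last by rewrite invf_div.
have y0 : y != 0.
  apply: contraTneq isT => y0; move/eqP: yE; rewrite y0 mul0r eq_sym mulf_eq0.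
  by rewrite expfz_eq0 (negPf uniformizer_neq0) andbF (negPf (zev_residue_neq0 s0)).
apply: (mulfI y0); rewrite mulVKf // mulrCA yE mulrA -expfzDr ?uniformizer_neq0 //.
by rewrite addNr expr0z mul1r.
Qed.

Lemma expansion1 : expansion 1 0 1.
Proof. by rewrite -{1}(zev1 z) -(zev1 e); apply: expansion_unit; rewrite zev1 oner_neq0. Qed.

Lemma expansionX y k c (m : nat) : expansion y k c ->
  expansion (y ^+ m) (k *+ m) (c ^+ m).
Proof.
move=> yk; elim: m => [|m IH]; first exact: expansion1.
by rewrite !exprS mulrS; apply: expansionM.
Qed.

Lemma expansionXz y k c (m : int) : expansion y k c ->
  expansion (y ^ m) (k * m) (c ^ m).
Proof.
case: m => m yk.
  by rewrite -!exprnP -mulrzz -pmulrn; exact: expansionX.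
by rewrite NegzE -!exprnN mulrN -mulrzz -pmulrn; apply/expansionV/expansionX.
Qed.

Lemma expansion_prod (I : eqType) (l : seq I) (y : I -> C) k c :
  (forall i, i \in l -> expansion (y i) (k i) (c i)) ->
  expansion (\prod_(i <- l) y i) (\sum_(i <- l) k i) (\prod_(i <- l) c i).
Proof.
elim: l => [|i l IH] yk; first by rewrite !big_nil; apply: expansion1.
rewrite !big_cons; apply: expansionM; first by apply: yk; rewrite mem_head.
by apply: IH => j jl; apply: yk; rewrite inE jl orbT.
Qed.

(** Cross-multiply and reduce at e: if the exponents differ by d > 0, the factor (1 - e^q)^d = 0
    faces a product of nonzero reductions; if d = 0, the two fractions agree. *)
Lemma expansion_uniq y k k' c c' : expansion y k c -> expansion y k' c' ->
  k = k' /\ c = c'.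
Proof.
wlog le_kk' : k k' c c' / k <= k' => [wlog1|].
  case/orP: (le_total k k') => kk' yk yk'; first exact: wlog1 yk yk'.
  by have [-> ->] := wlog1 _ _ _ _ kk' yk' yk.
case=> [s [t [s0 t0 yE ->]]] [s' [t' [s0' t0' yE' ->]]].
have [d kE] : exists d : nat, k' = k + d%:Z.
  by exists `|k' - k|%N; rewrite gez0_abs ?subr_ge0 // addrCA subrr addr0.
have : zev z (s * t' - (1 - 'X^q) ^+ d * (s' * t)) = 0.
  have lk0 : lam ^ k != 0 by rewrite expfz_neq0 ?uniformizer_neq0.
  have stE : lam ^ k * (zev z s * zev z t') = y * zev z t * zev z t'.
    by rewrite yE mulrA.
  have st'E : lam ^ k * (lam ^+ d * (zev z s' * zev z t)) = y * zev z t' * zev z t.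
    by rewrite yE' kE expfzDr ?uniformizer_neq0 // -exprnP !mulrA.
  apply: (mulfI lk0); rewrite mulr0 zevB !zevM zevX zev_uniformizer mulrBr.
  by rewrite stE st'E mulrAC subrr.
move/zev_residue_eq0/eqP; rewrite zevB !zevM zevX zev_uniformizer.
rewrite (prim_expr_order e_prim) subrr expr0n; case: d kE => [|d] -> /=.
  rewrite addr0 mul1r subr_eq0 => /eqP sE; split=> //.
  by apply/eqP; rewrite eqr_div // sE.
by rewrite mul0r subr0 mulf_eq0 (negPf s0) (negPf t0').
Qed.

Lemma uniformizer_conj a : zev z (\sum_(i < a) 'X^(q * i)) * lam = 1 - z ^+ (q * a).
Proof.
rewrite zev_sum mulrC -opprB mulNr -[RHS]opprB; congr (- _).
rewrite exprM [RHS]subrX1; congr (_ * _); apply: eq_bigr => i _.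
by rewrite zevXn exprM.
Qed.

(** The quotient of the two uniformizers is the sum of the z^(q i) for i < a, and each term reduces
    to 1 because e^q = 1. *)
Lemma expansion_uniformizer_conj a : ~~ (p %| a)%N ->
  expansion (1 - z ^+ (q * a)) 1 a%:R.
Proof.
move=> pa; rewrite -uniformizer_conj -[1 in X in expansion _ X _]add0r -[_%:R]mulr1.
apply: expansionM expansion_uniformizer.
have eE : zev e (\sum_(i < a) 'X^(q * i)) = a%:R.
  rewrite zev_sum (eq_bigr (fun=> 1)) ?sumr_const ?card_ord // => i _.
  by rewrite zevXn exprM (prim_expr_order e_prim) expr1n.
by rewrite -eE; apply: expansion_unit; rewrite eE -(dvdn_pcharf pchar_residue).
Qed.

Lemma expansion_int (m : int) : ~~ (p %| `|m|)%N -> expansion m%:~R 0 m%:~R.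
Proof.
by move=> pm; rewrite -(zevC z) -(zevC e); apply: expansion_unit; rewrite zevC residue_int_eq0.
Qed.

(** Value at 1 of 1 + X + ... + X^(p-1). It exhibits the total ramification: p is a product of p - 1
    conjugates of the uniformizer. *)
Lemma prime_uniformizers : p%:R = \prod_(1 <= a < p) (1 - z ^+ (q * a)) :> C.
Proof.
have zq : p.-primitive_root (z ^+ q).
  have := dvdn_prim_root z_prim (dvdn_mulr q (dvdnn p)).
  by rewrite mulKn ?prime_gt0.
have := factor_Xn_sub_1 zq; rewrite big_ltn ?prime_gt0 // expr0 subrX1 -polyC1.
move/(mulfI (monic_neq0 (monicXsubC _)))/(congr1 (horner^~ 1)).
rewrite horner_prod horner_sum (eq_bigr (fun a => 1 - z ^+ (q * a))) => [->|a _].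
  rewrite (eq_bigr (fun=> 1)) ?sumr_const ?card_ord // => i _.
  by rewrite hornerXn expr1n.
by rewrite hornerXsubC exprM.
Qed.

Lemma expansion_prime : expansion p%:R (p%:Z - 1) (\prod_(1 <= a < p) a%:R).
Proof.
have -> : p%:Z - 1 = \sum_(1 <= a < p) 1.
  by rewrite sumr_const_nat natz -subzn ?prime_gt0.
rewrite prime_uniformizers; apply: expansion_prod => a.
rewrite mem_index_iota => /andP[a0 ap]; apply: expansion_uniformizer_conj.
by rewrite gtnNdvd.
Qed.

Lemma rat_prime_part (x : rat) : x != 0 -> exists (a : int) (m d : int),
  [/\ ~~ (p %| `|m|)%N, ~~ (p %| `|d|)%N & x = p%:R ^ a * (m%:~R / d%:~R)].
Proof.
have int_part (m : int) : m != 0 -> exists a (m' : int),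
    ~~ (p %| `|m'|)%N /\ m = p%:Z ^+ a * m'.
  move=> m0; have am0 : (0 < `|m|)%N by rewrite absz_gt0.
  have [a pa mE] := pfactor_coprime p_pr am0.
  exists (logn p `|m|), (Num.sg m * a%:Z); split.
    by rewrite abszM absz_sg m0 mul1n absz_nat -prime_coprime.
  rewrite {1}[m]numEsg -abszE {1}mE PoszM -[Posz (p ^ _)]natz natrX natz.
  by rewrite mulrA mulrC.
move=> x0; have [a [m [pm mE]]] := int_part (numq x) (ltac:(by rewrite numq_eq0)).
have [b [d [pd dE]]] := int_part (denq x) (denq_neq0 x).
exists (a%:Z - b%:Z), m, d; split=> //.
rewrite -[x in LHS]divq_num_den mE dE !rmorphM /= !rmorphXn /=.
rewrite expfzDr ?intr_eq0; last by rewrite pnatr_eq0 -lt0n prime_gt0.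
by rewrite -exprnN -!exprnP invfM mulrACA.
Qed.

Lemma rat_expansion (a m d : int) : ~~ (p %| `|m|)%N -> ~~ (p %| `|d|)%N ->
  expansion (p%:R ^ a * (m%:~R / d%:~R)) ((p%:Z - 1) * a)
    ((\prod_(1 <= i < p) i%:R) ^ a * (m%:~R / d%:~R)).
Proof.
move=> pm pd; rewrite -[_ * a]addr0; apply: expansionM.
  exact: expansionXz expansion_prime.
rewrite -[0 in X in expansion _ X _](subrr 0) -[0 - 0]/(0 + - 0).
by apply: expansionM (expansion_int pm) (expansionV (expansion_int pd)).
Qed.

Lemma Fp_poly_lift (t : {poly 'F_p}) : exists t' : {poly int}, map_poly intr t' = t.
Proof.
exists (\poly_(i < size t) Posz (t`_i : 'F_p)%R); apply/polyP => i.
rewrite coef_map_id0 // coef_poly; case: ltnP => [_|ti]; last by rewrite nth_default.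
by rewrite -pmulrn natr_Zp.
Qed.

Lemma Fp_poly_ker (u : {poly int}) : map_poly intr u = 0 :> {poly 'F_p} ->
  exists u', u = p%:Z *: u'.
Proof.
move=> u0; exists (\poly_(i < size u) (u`_i %/ p)%Z); apply/polyP => i.
rewrite coefZ coef_poly; case: ltnP => [_|ui]; last by rewrite nth_default ?mulr0.
rewrite mulrC divzK // /dvdz /=.
move/(congr1 (fun t : {poly 'F_p} => t`_i)): u0; rewrite coef_map_id0 // coef0.
move/eqP; rewrite -(fmorph_eq0 Fp_K) rmorph_int residue_int_eq0.
by [].
Qed.

Lemma zev_reduction (s : {poly int}) :
  (map_poly Fp_K (map_poly intr s)).[e] = zev e s.
Proof.
rewrite -map_poly_comp; congr horner; apply: eq_map_poly => c /=.
by rewrite rmorph_int.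
Qed.

(** The uniformizer generates the maximal ideal of the localisation. Modulo p, let g be the gcd of s
    and X^q - 1, and let h and k lift (X^q - 1)/g and s/g. Then h s - k (X^q - 1) is divisible by p,
    and both p and z^q - 1 are multiples of [lam]. Since X^q - 1 is separable mod p and g vanishes
    at e, h does not. *)
Lemma residue_kernel (s : {poly int}) : zev e s = 0 -> exists h s',
  zev e h != 0 /\ zev z (h * s) = lam * zev z s'.
Proof.
move=> s0; pose sp : {poly 'F_p} := map_poly intr s.
pose Q : {poly 'F_p} := 'X^q - 1; pose g := gcdp sp Q.
have QE (A : comNzRingType) : map_poly intr ('X^q - 1) = 'X^q - 1 :> {poly A}.
  by rewrite rmorphB rmorph1 /= map_polyXn.
have [h hE] := Fp_poly_lift (Q %/ g); have [k kE] := Fp_poly_lift (sp %/ g).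
have [u uE] : exists u, h * s - k * ('X^q - 1) = p%:Z *: u.
  apply: Fp_poly_ker; rewrite rmorphB !rmorphM /= QE hE kE mulrC.
  by rewrite (divp_mulCA (dvdp_gcdl _ _) (dvdp_gcdr _ _)) mulrC subrr.
have Qsep : separable_poly (map_poly Fp_K Q).
  rewrite rmorphB rmorph1 /= map_polyXn; apply: separable_Xn_sub_1.
  by rewrite -(dvdn_pcharf pchar_residue) dvdn_prime2.
have Qe : root (map_poly Fp_K Q) e.
  by rewrite rmorphB rmorph1 /= map_polyXn rootE !hornerE (prim_expr_order e_prim) subrr.
exists h, ((\prod_(2 <= a < p) (1 - 'X^(q * a))) * u - k); split.
  have ge : root (map_poly Fp_K g) e.
    by rewrite gcdp_map root_gcd Qe andbT; apply/eqP; rewrite zev_reduction.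
  have gQ : map_poly Fp_K g * map_poly Fp_K (Q %/ g) %| map_poly Fp_K Q.
    by rewrite -rmorphM /= mulrC divpK ?dvdp_gcdr.
  have := coprimep_root (separable_coprime Qsep gQ) ge.
  by rewrite -zev_reduction hE.
have -> : h * s = k * ('X^q - 1) + p%:Z *: u by rewrite -uE addrC subrK.
have pE : p%:R = lam * zev z (\prod_(2 <= a < p) (1 - 'X^(q * a))).
  rewrite prime_uniformizers big_ltn ?prime_gt1 // muln1 zev_prod.
  by congr (_ * _); apply: eq_bigr => a _; rewrite zevB zev1 zevXn.
rewrite -mul_polyC zevB !zevM.
have -> : zev z (k * ('X^q - 1) + p%:Z%:P * u) =
   zev z k * zev z ('X^q - 1) + zev z p%:Z%:P * zev z u.
  by rewrite /zev rmorphD !rmorphM hornerD !hornerM.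
rewrite zevC -pmulrn pE zevB zevXn zev1.
ring.
Qed.

Lemma expansion_exists_int (s : {poly int}) : zev z s != 0 ->
  exists k c, expansion (zev z s) k c.
Proof.
move=> s0; have [u [N [N0 uN]]] := zev_inv z_prim s0.
have [kN [cN NE]] : exists k c, expansion N%:~R k c.
  have N0' : N%:~R != 0 :> rat by rewrite intr_eq0.
  have [a [m [d [pm pd NE]]]] := rat_prime_part N0'.
  have NE' : N%:~R = p%:R ^ a * (m%:~R / d%:~R) :> C.
    have := congr1 (ratr : rat -> C) NE.
    by rewrite ratr_int rmorphM fmorphXz rmorph_nat fmorph_div /= !ratr_int.
  by rewrite NE'; do 2!eexists; exact: rat_expansion.
(* Division by [lam], repeated until a unit appears or M divisions have been made; h collects the
   unit multipliers. *)
have iter M : exists (k : nat) h s', [/\ (k <= M)%N, zev e h != 0,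
     zev z (h * s) = lam ^+ k * zev z s' & k = M \/ zev e s' != 0].
  elim: M => [|M [k [h [s' [kM h0 hs]]]]].
    by exists 0%N, 1, s; rewrite zev1 oner_neq0 mul1r mul1r; split=> //; left.
  case=> [kE|s'0]; last by exists k, h, s'; split=> //; [exact: leqW|right].
  have [s'0|s'0] := eqVneq (zev e s') 0; last first.
    by exists k, h, s'; split=> //; [exact: leqW|right].
  have [h' [t [h'0 h't]]] := residue_kernel s'0.
  exists M.+1, (h' * h), t; rewrite zevM mulf_neq0 //; split=> //; last by left.
  by rewrite -mulrA zevM hs -kE mulrCA -zevM h't mulrA exprSr.
(* The exponent [kN] of N, a multiple of s, bounds the number of divisions: with k > [kN], the unit
   numerator in the expansion of N h would be a multiple of [lam] and reduce to 0. *)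
have [k [h [s' [_ h0 hs s'0]]]] := iter `|kN|.+1.
have {s'0} s'0 : zev e s' != 0.
  case: s'0 => // kE; have hN : expansion (zev z (u * (h * s))) kN (zev e h * cN).
    rewrite mulrCA zevM uN -[kN]add0r; exact: expansionM (expansion_unit h0) NE.
  have [a [b [a0 b0 abE _]]] := hN.
  have [d kd] : exists d : nat, k%:Z = kN + d.+1%:Z.
    exists `|(k%:Z - kN - 1)%R|%N; lia.
  have lk0 : lam ^ kN != 0 by rewrite expfz_neq0 ?uniformizer_neq0.
  have /zev_residue_eq0/eqP : zev z (a - (1 - 'X^q) ^+ d.+1 * (u * s' * b)) = 0.
    apply: (mulfI lk0); rewrite mulr0 zevB mulrBr -abE !zevM zevX zev_uniformizer -zevM hs.
    rewrite [lam ^+ k]exprnP kd expfzDr ?uniformizer_neq0 // -exprnP; ring.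
  rewrite zevB zevM zevX zev_uniformizer (prim_expr_order e_prim) subrr.
  by rewrite expr0n mul0r subr0 (negPf a0).
exists (0 + 1 * k%:Z + - 0), (zev e s' * 1 ^ k%:Z * (zev e h)^-1).
have -> : zev z s = zev z s' * lam ^ k%:Z * (zev z h)^-1.
  rewrite mulrC [zev z s' * _]mulrC -[_ * zev z s']/(lam ^+ k * zev z s') -hs zevM mulKf //.
  exact: zev_residue_neq0.
apply: expansionM (expansionV (expansion_unit h0)).
by apply: expansionM (expansionXz _ expansion_uniformizer); apply: expansion_unit.
Qed.

Lemma expansion_exists (f : {poly rat}) : (map_poly ratr f).[z] != 0 ->
  exists k c, expansion (map_poly ratr f).[z] k c.
Proof.
have [s [N N0 ->]] := rat_poly_scale f; rewrite linearZ /= hornerZ fmorphV /= ratr_int.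
rewrite horner_ratr_intr mulf_eq0 negb_or => /andP[_ s0].
have [k [c sE]] := expansion_exists_int s0.
have N0' : zev z N%:P != 0 by rewrite zevC intr_eq0.
have [k' [c' NE]] := expansion_exists_int N0'.
by exists (- k' + k), (c'^-1 * c); rewrite -(zevC z); apply: expansionM (expansionV NE) sE.
Qed.

(* The automorphism z |-> z^j acts on reductions as a power of the Frobenius,
   twisted by its effect a on the uniformizer. *)
Lemma expansion_Galois (f : {poly rat}) k c j a i :
  coprime j (p * q) -> (j = a %[mod p])%N -> (j = p ^ i %[mod q])%N ->
  expansion (map_poly ratr f).[z] k c ->
  expansion (map_poly ratr f).[z ^+ j] k (c ^+ (p ^ i) * a%:R ^ k).
Proof.
move=> jn ja ji [s [t [s0 t0 yE cE]]].
have pj : ~~ (p %| a)%N.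
  rewrite /dvdn -ja -/(dvdn p j) -prime_coprime // coprime_sym.
  by move: jn; rewrite coprimeMr => /andP[].
have Frob u : zev (e ^+ j) u = zev e u ^+ (p ^ i).
  rewrite -(prim_expr_mod e_prim) ji (prim_expr_mod e_prim).
  elim: i {ji} => [|i IH]; first by rewrite !expr1.
  by rewrite expnSr !exprM -IH -zev_Frobenius // pchar_residue.
have comp_unit u : zev e u != 0 -> expansion (zev (z ^+ j) u) 0 (zev e u ^+ (p ^ i)).
  by move=> u0; rewrite -zev_comp -Frob -zev_comp; apply: expansion_unit;
     rewrite zev_comp Frob expf_neq0.
have lam_j : expansion (1 - (z ^+ j) ^+ q) 1 a%:R.
  have -> : (z ^+ j) ^+ q = z ^+ (q * a).
    rewrite -exprM [(q * a)%N]mulnC; apply/eqP; rewrite (eq_prim_root_expr z_prim).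
    by rewrite -!muln_modl ja.
  exact: expansion_uniformizer_conj.
have conj_neq0 u : zev e u != 0 -> zev (z ^+ j) u != 0.
  move=> u0; rewrite -zev_comp; apply: zev_residue_neq0.
  by rewrite zev_comp Frob expf_neq0.
have lamj0 : 1 - (z ^+ j) ^+ q != 0.
  have zj : (p * q).-primitive_root (z ^+ j) by rewrite prim_root_exp_coprime.
  rewrite subr_eq0 eq_sym -(prim_order_dvd zj); apply/negP => /dvdn_leq.
  by rewrite prime_gt0 // leqNgt ltn_Pmull ?prime_gt1 ?prime_gt0 // => /(_ isT).
have yjE : (map_poly ratr f).[z ^+ j] =
    zev (z ^+ j) s * (1 - (z ^+ j) ^+ q) ^ k * (zev (z ^+ j) t)^-1.
  (* The exponent k may be negative; splitting it turns the expansion of y into a polynomial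
     relation g(z) = 0, which [Galois_conjugate] carries to z^j. *)
  have [k1 [k2 kE]] : exists k1 k2 : nat, k = k1%:Z - k2%:Z.
    by case: k yE => m _; [exists m, 0%N; lia | exists 0%N, m.+1; lia].
  pose g : {poly rat} := f * map_poly intr (t * (1 - 'X^q) ^+ k2)
    - map_poly intr ((1 - 'X^q) ^+ k1 * s).
  have gE (w : C) : (map_poly ratr g).[w] = (map_poly ratr f).[w] * zev w t *
      (1 - w ^+ q) ^+ k2 - (1 - w ^+ q) ^+ k1 * zev w s.
    rewrite /g rmorphB /= rmorphM /= hornerD hornerN hornerM !horner_ratr_intr !zevM !zevX.
    by rewrite !zev_uniformizer mulrA.
  have : (map_poly ratr g).[z] = 0.
    rewrite gE yE kE expfzDr ?uniformizer_neq0 // -exprnN -!exprnP.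
    by rewrite mulrAC divfK ?expf_neq0 ?uniformizer_neq0 // subrr.
  move/(Galois_conjugate z_prim jn)/eqP; rewrite gE subr_eq0 => /eqP zjE.
  apply: (mulIf (conj_neq0 t t0)); rewrite mulfVK ?conj_neq0 //.
  rewrite kE expfzDr // -exprnN -exprnP mulrA [_ * _ ^+ k1]mulrC -zjE.
  by rewrite mulfK ?expf_neq0.
have := expansionM (expansionM (comp_unit s s0) (expansionXz k lam_j))
                   (expansionV (comp_unit t t0)).
by rewrite add0r mul1r oppr0 addr0 yjE cE expr_div_n [X in _ -> expansion _ _ X]mulrAC.
Qed.

End PrimeAbove.

(** * Norms from abelian fields of conductor p q *)

Lemma closed_prim_root_exists (K : closedFieldType) n :
  n%:R != 0 :> K -> exists z : K, n.-primitive_root z.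
Proof.
move=> n0; have n_gt0 : (0 < n)%N by case: n n0 => //; rewrite eqxx.
have [rs] := closed_field_poly_normal ('X^n - 1 : {poly K}).
rewrite (monicP _) ?monicXnsubC // scale1r => rsE.
have rs_uniq : uniq rs by rewrite -separable_prod_XsubC -rsE separable_Xn_sub_1.
have rs_size : size rs = n.
  by have := size_XnsubC (1 : K) n_gt0; rewrite rsE size_prod_XsubC => -[].
have rs_root : all n.-unity_root rs.
  by apply/allP => y yrs; rewrite /root_of_unity rsE root_prod_XsubC.
have /hasP[z _ z_prim] := has_prim_root n_gt0 rs_root rs_uniq (eq_leq (esym rs_size)).
by exists z.
Qed.

Lemma expansion_neq0 (C : numFieldType) q (z : C) (K : fieldType) (e : K) y k c :
  expansion q z e y k c -> c != 0.
Proof. by case=> s [t [s0 t0 _ ->]]; rewrite mulf_neq0 ?invr_eq0. Qed.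

(* Local triviality at p of the norm residue symbol, for the extension of Q fixed
   by the residues a mod p, b mod q with b in T. *)
Lemma norm_prime_part (C : numFieldType) p q (z : C) (f : {poly rat}) T (x : rat) :
  prime p -> prime q -> p != q -> (p * q).-primitive_root z ->
  perm_eq [seq (p * b %% q)%N | b <- T] T -> all (coprime q) T ->
  x != 0 ->
  ratr x = \prod_(b <- T) \prod_(1 <= a < p)
             (map_poly ratr f).[z ^+ chinese p q a b] ->
  exists (a m d : int), [/\ ~~ (p %| `|m|)%N, ~~ (p %| `|d|)%N,
    (m = d %[mod p])%Z, x = p%:R ^ a * (m%:~R / d%:~R)
    & p%:R ^ a = 1 :> 'F_q].
Proof.
move=> p_pr q_pr pq z_prim Tp Tq x0 xE.
have [K [Fp_K _]] := countable_algebraic_closure 'F_p.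
have chK := pchar_residue Fp_K p_pr.
have p_q : coprime p q by rewrite prime_coprime // dvdn_prime2.
have q0K : q%:R != 0 :> K by rewrite -(dvdn_pcharf chK) dvdn_prime2.
have [e e_prim] := closed_prim_root_exists q0K.
(* At z this is the conjugate with residues 1 mod p and b mod q, the base point from which inertia
   and Frobenius reach the others. *)
pose fb b := f \Po 'X^(chinese p q 1 b).
have fbE b w : (map_poly ratr (fb b)).[w] = (map_poly ratr f).[w ^+ chinese p q 1 b] :> C.
  by rewrite map_comp_poly map_polyXn horner_comp hornerXn.
have [kc kcP] : exists kc : nat -> int * K, forall b, b \in T ->
    expansion q z e (map_poly ratr (fb b)).[z] (kc b).1 (kc b).2.
  suff /choice[kc kcP] : forall b, exists kc : int * K, b \in T ->
      expansion q z e (map_poly ratr (fb b)).[z] kc.1 kc.2 by exists kc.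
  move=> b; have [bT|bT] := boolP (b \in T); last by exists (0, 1).
  have yb0 : (map_poly ratr (fb b)).[z] != 0.
    rewrite fbE; move: x0; rewrite -(fmorph_eq0 (ratr : {rmorphism rat -> C})) /= xE.
    apply: contraNneq => yb0; rewrite prodf_seq_eq0; apply/hasP; exists b => //=.
    by rewrite big_ltn ?prime_gt1 // yb0 mul0r.
  have [k [c kcE]] := expansion_exists Fp_K p_pr q_pr pq z_prim e_prim yb0.
  by exists (k, c).
have chin_exp a b a' b' u v :
    (a * a' = u %[mod p])%N -> (b * b' = v %[mod q])%N ->
    (z ^+ chinese p q a b) ^+ chinese p q a' b' = z ^+ chinese p q u v.
  move=> au bv; rewrite -exprM; apply/eqP; rewrite (eq_prim_root_expr z_prim).
  rewrite chinese_remainder //; apply/andP; split; apply/eqP.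
    by rewrite chinese_modl // -au -modnMm !chinese_modl // modnMm.
  by rewrite chinese_modr // -bv -modnMm !chinese_modr // modnMm.
have Gal_exp b a v i u : b \in T -> ~~ (p %| a)%N -> (v = p ^ i %[mod q])%N ->
    (b * v = u %[mod q])%N ->
    expansion q z e (map_poly ratr f).[z ^+ chinese p q a u] (kc b).1
      ((kc b).2 ^+ (p ^ i) * a%:R ^ (kc b).1).
  move=> bT pa vE bvu.
  rewrite -(@chin_exp a v 1%N b) ?mul1n ?muln1 //; last by rewrite mulnC.
  rewrite -fbE; apply: (expansion_Galois Fp_K) => //.
  - rewrite coprimeMr; apply/andP; split.
      by rewrite -coprime_modl chinese_modl // coprime_modl coprime_sym prime_coprime.
    rewrite -coprime_modl chinese_modr // coprime_modl -coprime_modl vE coprime_modl.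
    by rewrite coprimeXl.
  - by rewrite chinese_modl.
  - by rewrite chinese_modr.
  - exact: kcP.
pose k b := (kc b).1; pose c b := (kc b).2.
(* Two expansions of the conjugate with residues 1 and p b: the one chosen for p b, and the
   Frobenius image of the one chosen for b. *)
have kc_p b : b \in T -> k (p * b %% q)%N = k b /\ c (p * b %% q)%N = c b ^+ p.
  move=> bT; have pbT : (p * b %% q)%N \in T.
    by rewrite -(perm_mem Tp); apply: map_f.
  have p1 : ~~ (p %| 1)%N by rewrite dvdn1 neq_ltn prime_gt1 ?orbT.
  have := @Gal_exp b 1%N p 1%N (p * b %% q)%N bT p1.
  rewrite expn1 modn_mod [(b * p)%N]mulnC mulr1n exp1rz mulr1 => /(_ erefl erefl).
  have := kcP _ pbT; rewrite fbE => h1 h2.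
  exact: (expansion_uniq Fp_K p_pr q_pr pq z_prim e_prim h1 h2).
pose W : K := \prod_(1 <= a < p) a%:R.
have W0 : W != 0.
  rewrite /W prodf_seq_neq0; apply/allP => a; rewrite mem_index_iota /=.
  by case/andP=> a0 ap; rewrite -(dvdn_pcharf chK) gtnNdvd.
have row_exp b : b \in T -> expansion q z e
    (\prod_(1 <= a < p) (map_poly ratr f).[z ^+ chinese p q a b])
    ((p%:Z - 1) * k b) (c b ^+ p.-1 * W ^ k b).
  move=> bT; have -> : (p%:Z - 1) * k b = \sum_(1 <= a < p) k b.
    rewrite sumr_const_nat -mulr_natl; congr (_ * _).
    by rewrite natz -subzn ?prime_gt0.
  have -> : c b ^+ p.-1 * W ^ k b = \prod_(1 <= a < p) (c b * a%:R ^ k b).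
    rewrite big_split prodr_const_nat subn1; congr (_ * _).
    by apply: (big_morph (fun y => y ^ k b)) => [y y'|]; rewrite ?expfzMl ?exp1rz.
  apply: (expansion_prod p_pr q_pr z_prim) => // a; rewrite mem_index_iota => /andP[a0 ap].
  rewrite -[c b]expr1 -(expn0 p); apply: (Gal_exp b a 1%N) => //.
  - by rewrite gtnNdvd.
  - by rewrite muln1.
have [a [m [d [pm pd xE']]]] := rat_prime_part p_pr x0.
exists a, m, d.
have xpE : ratr x = p%:R ^ a * (m%:~R / d%:~R) :> C.
  by rewrite xE' rmorphM fmorphXz rmorph_nat fmorph_div /= !ratr_int.
have := rat_expansion Fp_K p_pr q_pr pq z_prim e_prim a pm pd.
rewrite -xpE xE => x_exp1.
have x_exp2 := expansion_prod p_pr q_pr z_prim row_exp.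
have [aE cE] := expansion_uniq Fp_K p_pr q_pr pq z_prim e_prim x_exp1 x_exp2.
have {}aE : a = \sum_(b <- T) k b.
  apply: (mulfI (_ : p%:Z - 1 != 0)); last by rewrite aE mulr_sumr.
  by rewrite subr_eq0; have := prime_gt1 p_pr; lia.
pose cT := \prod_(b <- T) c b.
have cT0 : cT != 0.
  rewrite /cT big_seq prodf_seq_neq0; apply/allP => b _; apply/implyP => bT.
  exact: expansion_neq0 (kcP b bT).
have cTp : cT ^+ p.-1 = 1.
  apply: (mulIf cT0); rewrite mul1r -exprSr prednK ?prime_gt0 //.
  rewrite -prodrXl -[RHS](perm_big _ Tp) big_map /=.
  by apply: eq_big_seq => b /kc_p[_ ->].
have md : m%:~R / d%:~R = 1 :> K.
  apply: (mulfI (expfz_neq0 a W0)); rewrite cE mulr1 big_split /= prodrXl -/cT cTp mul1r.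
  rewrite aE; elim/big_rec2: _ => [|b y1 y2 _ ->]; first by rewrite expr0z.
  by rewrite expfzDr.
split=> //.
- apply/eqP; rewrite eqz_mod_dvd dvdzE /= -(residue_int_eq0 Fp_K p_pr).
  have d0 : d%:~R != 0 :> K by rewrite (residue_int_eq0 Fp_K p_pr).
  by rewrite rmorphB subr_eq0 /= -[X in X == _](divfK d0) md mul1r.
- have q0 b : b \in T -> b%:R != 0 :> 'F_q.
    move=> bT; rewrite -(dvdn_pcharf (pchar_Fp q_pr)) -prime_coprime //.
    exact: (allP Tq).
  pose P : 'F_q := \prod_(b <- T) b%:R ^ k b.
  have P0 : P != 0.
    rewrite /P big_seq prodf_seq_neq0; apply/allP => b _; apply/implyP => bT.
    by rewrite expfz_neq0 ?q0.
  have p0 : p%:R != 0 :> 'F_q.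
    by rewrite -(dvdn_pcharf (pchar_Fp q_pr)) dvdn_prime2 // eq_sym.
  apply: (mulIf P0); rewrite mul1r [in RHS]/P -[RHS](perm_big _ Tp) big_map /=.
  rewrite (eq_big_seq (fun b => p%:R ^ k b * b%:R ^ k b)) => [|b /kc_p[-> _]].
    rewrite big_split /= -/P aE; congr (_ * _).
    by elim/big_rec2: _ => [|b y1 y2 _ <-]; rewrite ?expr0z ?expfzDr.
  rewrite -expfzMl -natrM; congr (_ ^ _); apply/eqP.
  by rewrite -Fp_nat_mod // modn_mod Fp_nat_mod.
Qed.

(** * Residues modulo p q *)

Lemma eq_Fp_nat q (a b : nat) : prime q -> (a%:R == b%:R :> 'F_q) = (a == b %[mod q])%N.
Proof.
move=> q_pr; apply/eqP/eqP => [/(congr1 (@nat_of_ord _))|ab].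
  by rewrite !val_Fp_nat.
by apply/val_inj; rewrite /= !val_Fp_nat.
Qed.

Lemma Fp_fermat q (y : 'F_q) : prime q -> y != 0 -> y ^+ q.-1 = 1.
Proof.
move=> q_pr y0; have := expf_card y; rewrite card_Fp // => yq.
by apply: (mulfI y0); rewrite -exprS prednK ?prime_gt0 // mulr1.
Qed.

Lemma expr_coprime_eq1 (A : fieldType) (y : A) m n : coprime m n ->
  y ^+ m = 1 -> y ^+ n = 1 -> y = 1.
Proof.
case: m => [|m]; first by rewrite /coprime gcd0n => /eqP->.
move=> mn ym yn; have [d d_prim dm] := prim_order_exists (ltn0Sn m) ym.
have dn : (d %| n)%N by rewrite (prim_order_dvd d_prim) yn.
have : (d %| gcdn m.+1 n)%N by rewrite dvdn_gcd dm.
rewrite (eqP mn) dvdn1 => /eqP d1.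
by have := prim_expr_order d_prim; rewrite d1 expr1.
Qed.

(** * The r-th powers mod q as representatives modulo the r-th roots of unity *)

Section PowerTransversal.
Variables (q r k : nat).
Hypotheses (q_pr : prime q) (r_pr : prime r).
Hypotheses (q_r : (q = 1 %[mod r])%N) (q_r2 : (q <> 1 %[mod r ^ 2])%N).
Hypotheses (kr : (k ^ r = 1 %[mod q])%N) (k1 : (k <> 1 %[mod q])%N).

Let kq : r.-primitive_root (k%:R : 'F_q).
Proof.
have kr1 : (k%:R : 'F_q) ^+ r = 1.
  by apply/eqP; rewrite -natrX (eq_Fp_nat _ 1 q_pr) kr.
have [d d_prim /(primeP r_pr).2/orP[]/eqP dE] := prim_order_exists (prime_gt0 r_pr) kr1.
  case: k1; apply/eqP; rewrite -(eq_Fp_nat _ 1 q_pr).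
  by have := prim_expr_order d_prim; rewrite dE expr1 => ->.
by rewrite -dE.
Qed.

Let r_q1 : (r %| q.-1)%N.
Proof. by rewrite -subn1 -eqn_mod_dvd ?prime_gt0 //; apply/eqP. Qed.

Let e := (q.-1 %/ r)%N.

(** Here q not congruent to 1 mod r^2 enters: r divides q - 1 = r e exactly once. *)
Let r_e : coprime r e.
Proof.
rewrite prime_coprime //; apply/negP => re; apply: q_r2; apply/eqP.
rewrite eqn_mod_dvd ?prime_gt0 // subn1 -(divnK r_q1).
by rewrite expnS expn1 dvdn_pmul2r ?prime_gt0.
Qed.

Definition power_residues := [seq t <- iota 1 q.-1 | `[< rth_power_mod r t q >]].

Lemma power_residues_coprime : all (coprime q) power_residues.
Proof.
apply/allP => t; rewrite mem_filter mem_iota add1n (prednK (prime_gt0 q_pr)).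
by case/and3P=> _ t0 tq; rewrite prime_coprime // gtnNdvd.
Qed.

Lemma residue_neq0 t : coprime q t -> t%:R != 0 :> 'F_q.
Proof. by move=> qt; rewrite -(dvdn_pcharf (pchar_Fp q_pr)) -prime_coprime. Qed.

Lemma mem_power_residues t : coprime q t ->
  (t %% q \in power_residues)%N = `[< exists y : 'F_q, y ^+ r = t%:R >].
Proof.
move=> qt; rewrite mem_filter mem_iota add1n (prednK (prime_gt0 q_pr)) ltn_mod.
rewrite (prime_gt0 q_pr) lt0n andbT -/(dvdn q t) -prime_coprime // qt andbT; apply/asboolP/asboolP.
  case=> y yt; exists y%:R; apply/eqP; rewrite -natrX eq_Fp_nat // yt.
  by rewrite modn_mod.
case=> y yt; exists (nat_of_ord y); apply/eqP; rewrite modn_mod -eq_Fp_nat // natrX.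
by rewrite natr_Zp yt.
Qed.

(** The r-th powers form a group containing a, so translation by a permutes them. Through this lemma
    the hypotheses that q1 and q2 are r-th powers modulo each other reach [norm_prime_part]. *)
Lemma power_residues_mul a : coprime q a -> rth_power_mod r a q ->
  perm_eq [seq (a * t %% q)%N | t <- power_residues] power_residues.
Proof.
move=> qa [y ya]; have T_uniq : uniq power_residues by rewrite filter_uniq ?iota_uniq.
have mul_inj : {in power_residues &, injective (fun t => a * t %% q)%N}.
  move=> t t'; rewrite !mem_filter !mem_iota add1n (prednK (prime_gt0 q_pr)).
  case/and3P=> _ _ tq /and3P[_ _ t'q] /eqP; rewrite -eq_Fp_nat // !natrM.
  move/eqP/(mulfI (residue_neq0 qa))/eqP; rewrite eq_Fp_nat // !modn_small //.
  by move/eqP.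
have sub : {subset [seq (a * t %% q)%N | t <- power_residues] <= power_residues}.
  move=> _ /mapP[t tT ->]; have qt := allP power_residues_coprime t tT.
  rewrite mem_power_residues ?coprimeMr ?qa //; apply/asboolP.
  move: tT; rewrite mem_filter => /andP[/asboolP[w wt] _].
  exists (y%:R * w%:R); rewrite exprMn -!natrX -natrM; apply/eqP.
  by rewrite eq_Fp_nat // -modnMm ya wt modnMm.
have u_map : uniq [seq (a * t %% q)%N | t <- power_residues] by rewrite map_inj_in_uniq.
have [|_ eqT] := uniq_min_size u_map sub; first by rewrite size_map.
exact: uniq_perm.
Qed.

(** As r and e are coprime, the units mod q are the direct product of the r-th powers, of order e,
    and the r-th roots of unity, generated by k. *)
Lemma power_residues_transversal :
  perm_eq [seq (t * k ^ l %% q)%N | t <- power_residues, l <- iota 0 r] (iota 1 q.-1).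
Proof.
have T_uniq : uniq power_residues by rewrite filter_uniq ?iota_uniq.
have k0 : coprime q k.
  rewrite prime_coprime // (dvdn_pcharf (pchar_Fp q_pr)) (prim_root_eq0 kq).
  by rewrite -lt0n prime_gt0.
apply: uniq_perm; rewrite ?iota_uniq //.
  apply: allpairs_uniq; rewrite ?iota_uniq // => -[t l] [t' l'].
  case/allpairsP=> -[t1 l1] /= [t1T l1r [-> ->]].
  case/allpairsP=> -[t2 l2] /= [t2T l2r [-> ->]] /eqP.
  rewrite -eq_Fp_nat // !natrM !natrX => /eqP tk.
  have [y yt] : exists y : 'F_q, y ^+ r = t1%:R.
    apply/asboolP; rewrite -mem_power_residues ?(allP power_residues_coprime) //.
    rewrite modn_small //; move: t1T.
    by rewrite mem_filter mem_iota add1n (prednK (prime_gt0 q_pr)) => /and3P[].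
  have [y' yt'] : exists y : 'F_q, y ^+ r = t2%:R.
    apply/asboolP; rewrite -mem_power_residues ?(allP power_residues_coprime) //.
    rewrite modn_small //; move: t2T.
    by rewrite mem_filter mem_iota add1n (prednK (prime_gt0 q_pr)) => /and3P[].
  have t1_0 := residue_neq0 (allP power_residues_coprime _ t1T).
  have t2_0 := residue_neq0 (allP power_residues_coprime _ t2T).
  have kl0 i : k%:R ^+ i != 0 :> 'F_q by rewrite expf_neq0 ?residue_neq0.
  have y_neq0 (w : 'F_q) s : s != 0 -> w ^+ r = s -> w != 0.
    by move=> s0 ws; apply: contraNneq s0 => w0; rewrite -ws w0 expr0n eqn0Ngt prime_gt0.
  have y0 := y_neq0 _ _ t1_0 yt; have y'0 := y_neq0 _ _ t2_0 yt'.
  have wE : (y / y') ^+ r = k%:R ^+ l2 / k%:R ^+ l1.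
    by rewrite expr_div_n yt yt'; apply/eqP; rewrite eqr_div // tk mulrC.
  (* This element is killed by r, being a quotient of powers of k, and by e, being an r-th power. *)
  have w1 : (y / y') ^+ r = 1.
    apply: (expr_coprime_eq1 r_e).
      by rewrite wE expr_div_n -!exprM ![(_ * r)%N]mulnC !exprM (prim_expr_order kq) !expr1n divr1.
    by rewrite -exprM mulnC divnK // Fp_fermat // mulf_neq0 ?invr_eq0.
  have t12 : t1 = t2.
    move: w1; rewrite expr_div_n yt yt' => /divr1_eq/eqP; rewrite eq_Fp_nat //.
    move: t1T t2T; rewrite !mem_filter !mem_iota add1n (prednK (prime_gt0 q_pr)).
    by case/and3P=> _ _ t1q /and3P[_ _ t2q]; rewrite !modn_small // => /eqP.
  congr (_, _) => //; move: tk; rewrite t12 => /(mulfI t2_0)/eqP.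
  rewrite (eq_prim_root_expr kq); move: l1r l2r; rewrite !mem_iota !add0n /= => l1r l2r.
  by rewrite !modn_small // => /eqP.
move=> v; rewrite mem_iota add1n (prednK (prime_gt0 q_pr)).
apply/allpairsP/andP => [[[t l] /= [tT _ ->]]|[v0 vq]].
  rewrite ltn_mod (prime_gt0 q_pr) lt0n -/(dvdn q (t * k ^ l)) -prime_coprime //.
  by rewrite coprimeMr coprimeXr // (allP power_residues_coprime).
have qv : coprime q v by rewrite prime_coprime // gtnNdvd.
(* The two idempotents of Z/r x Z/e: a + b = 1 mod q - 1, v^a is an r-th power because r divides a,
   and v^b is an r-th root of unity because e divides b. *)
pose a := chinese r e 0 1; pose b := chinese r e 1 0.
have q1E : q.-1 = (r * e)%N by rewrite mulnC divnK.
have vab : (v%:R : 'F_q) ^+ a * v%:R ^+ b = v%:R.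
  rewrite -exprD -[RHS]expr1; have ve := Fp_fermat q_pr (residue_neq0 qv).
  rewrite -(expr_mod _ ve) -[RHS](expr_mod _ ve) q1E; congr (_ ^+ _); apply/eqP.
  rewrite chinese_remainder //; apply/andP; split; apply/eqP.
    by rewrite -modnDm /a /b !chinese_modl // modnDm.
  by rewrite -modnDm /a /b !chinese_modr // modnDm.
have vb : (v%:R ^+ b : 'F_q) ^+ r = 1.
  have eb : (e %| b)%N by rewrite /dvdn /b chinese_modr // mod0n.
  rewrite -exprM -(divnK eb) -mulnA [(e * r)%N]mulnC -q1E mulnC exprM.
  by rewrite Fp_fermat ?expr1n // residue_neq0.
have [l vl] := prim_rootP kq vb.
pose t : 'F_q := v%:R ^+ a.
have t0 : t != 0 by rewrite expf_neq0 // residue_neq0.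
have qt : coprime q (nat_of_ord t).
  by rewrite prime_coprime // (dvdn_pcharf (pchar_Fp q_pr)) natr_Zp.
have tE : (t %% q = t)%N by rewrite modn_small // -[q in (_ < q)%N](card_Fp q_pr) card_ord.
exists (nat_of_ord t, nat_of_ord l); rewrite mem_iota /= ltn_ord; split=> //.
  rewrite -tE mem_power_residues //; apply/asboolP; exists (v%:R ^+ (a %/ r)).
  by rewrite -exprM divnK ?natr_Zp // /dvdn /a chinese_modl // mod0n.
rewrite -[LHS](modn_small vq); apply/eqP; rewrite -eq_Fp_nat // natrM natrX natr_Zp.
by rewrite -vl vab.
Qed.

End PowerTransversal.

(** * Representatives of the residues mod pq under multiplication by k *)

Lemma map_uniq_inj (T1 T2 : eqType) (f : T1 -> T2) s :
  uniq (map f s) -> {in s &, injective f}.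
Proof.
move=> fs x y xs ys fxy; rewrite -(nth_index x xs) -(nth_index x ys).
congr nth; apply/eqP; rewrite -(nth_uniq (f x) _ _ fs) ?size_map ?index_mem //.
by rewrite !(nth_map x) ?index_mem // !nth_index // fxy.
Qed.

Lemma residue_transversal_lift u v r k T :
  perm_eq [seq (t * k ^ l %% v)%N | t <- T, l <- iota 0 r] (iota 1 v.-1) ->
  perm_eq [seq (j * k ^ l %% (u * v))%N | j <- [seq u * t | t <- T]%N, l <- iota 0 r]
          [seq u * i | i <- iota 1 v.-1]%N.
Proof.
move=> perm_v.
have -> : [seq (j * k ^ l %% (u * v))%N | j <- [seq u * t | t <- T]%N, l <- iota 0 r] =
    [seq (u * (t * k ^ l %% v))%N | t <- T, l <- iota 0 r].
  by rewrite allpairs_mapl; apply: eq_allpairs => t l; rewrite muln_modr mulnA.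
by rewrite -map_allpairs; apply: perm_map.
Qed.

(** Nonzero residues split into multiples of q, multiples of p and units. Multiplication by k acts
    freely on units already through the residue mod q, so restricting that residue to [Tq] uses up
    the whole action and leaves the residue mod p arbitrary: the residue mod q determines b and l,
    and then k^l cancels mod p. *)
Lemma residue_transversal p q r k Tp Tq : prime p -> prime q -> p != q -> (0 < r)%N ->
  uniq Tq -> all (coprime q) Tq -> coprime p k -> coprime q k ->
  perm_eq [seq (t * k ^ l %% p)%N | t <- Tp, l <- iota 0 r] (iota 1 p.-1) ->
  perm_eq [seq (t * k ^ l %% q)%N | t <- Tq, l <- iota 0 r] (iota 1 q.-1) ->
  perm_eq (0%N :: [seq (j * k ^ l %% (p * q))%N |
       j <- [seq q * t | t <- Tp]%N ++ [seq p * t | t <- Tq]%N ++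
            [seq chinese p q a b | b <- Tq, a <- index_iota 1 p],
       l <- iota 0 r])
    (iota 0 (p * q)).
Proof.
move=> p_pr q_pr pq r0 Tq_uniq Tq_cop pk qk permp permq.
have [p0 q0] := (prime_gt0 p_pr, prime_gt0 q_pr).
have p_q : coprime p q by rewrite prime_coprime // dvdn_prime2.
have chin_inj a b l a' b' l' : a \in index_iota 1 p -> a' \in index_iota 1 p ->
    b \in Tq -> b' \in Tq -> l \in iota 0 r -> l' \in iota 0 r ->
    (chinese p q a b * k ^ l = chinese p q a' b' * k ^ l' %[mod p * q])%N ->
    [/\ a = a', b = b' & l = l'].
  move=> a1 a1' bT bT' lr lr' /eqP; rewrite chinese_remainder // => /andP[/eqP ep /eqP eq].
  have [bb ll] : b = b' /\ l = l'.
    have u_pairs : uniq [seq (bl.1 * k ^ bl.2 %% q)%N |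
        bl <- [seq (t, l0) | t <- Tq, l0 <- iota 0 r]].
      by rewrite map_allpairs (perm_uniq permq) iota_uniq.
    have bl : (b * k ^ l = b' * k ^ l' %[mod q])%N.
      rewrite -modnMml -(chinese_modr p_q a b) modnMml eq -modnMml chinese_modr //.
      by rewrite modnMml.
    have mem_pair t l0 : t \in Tq -> l0 \in iota 0 r ->
        (t, l0) \in [seq (t, l0) | t <- Tq, l0 <- iota 0 r].
      by move=> tT l0r; apply/allpairsP; exists (t, l0).
    have [-> ->] // := map_uniq_inj u_pairs (mem_pair _ _ bT lr) (mem_pair _ _ bT' lr') bl.
  split=> //; move: ep; rewrite ll -modnMml chinese_modl // modnMml.
  rewrite -[RHS]modnMml chinese_modl // modnMml => /eqP.
  rewrite -eq_Fp_nat // !natrM => /eqP/(mulIf (residue_neq0 p_pr _))/eqP.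
  rewrite coprimeXr // eq_Fp_nat // => /(_ isT).
  move: a1 a1'; rewrite !mem_index_iota => /andP[_ ap] /andP[_ ap'].
  by rewrite !modn_small // => /eqP.
rewrite !allpairs_cat.
set E1 := [seq _ | j <- map _ Tp, l <- _].
set E2 := [seq _ | j <- map _ Tq, l <- _].
set E3 := [seq _ | j <- _, l <- _].
have permE1 : perm_eq E1 [seq q * i | i <- iota 1 p.-1]%N.
  by rewrite /E1 [(p * q)%N]mulnC; apply: residue_transversal_lift.
have permE2 : perm_eq E2 [seq p * i | i <- iota 1 q.-1]%N by apply: residue_transversal_lift.
have {permE1 permE2} permE : perm_eq (0%N :: E1 ++ E2 ++ E3)
    (0%N :: [seq q * i | i <- iota 1 p.-1]%N ++ [seq p * i | i <- iota 1 q.-1]%N ++ E3).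
  by rewrite perm_cons; do 2!apply: perm_cat => //.
apply: (perm_trans permE).
have E3_cop v : v \in E3 -> [/\ ~~ (p %| v)%N, ~~ (q %| v)%N & (v < p * q)%N].
  case/allpairsP=> -[j l] /= [/allpairsP[[b a] /= [bT a1 ->]] _ ->].
  rewrite ltn_mod muln_gt0 p0 q0 -!prime_coprime //; split=> //.
    rewrite -coprime_modr modn_dvdm ?dvdn_mulr // coprime_modr coprimeMr coprimeXr // andbT.
    rewrite -coprime_modr chinese_modl // coprime_modr prime_coprime //.
    by move: a1; rewrite mem_index_iota => /andP[a0 ap]; rewrite gtnNdvd.
  rewrite -coprime_modr modn_dvdm ?dvdn_mull // coprime_modr coprimeMr coprimeXr // andbT.
  by rewrite -coprime_modr chinese_modr // coprime_modr (allP Tq_cop).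
have E3_uniq : uniq E3.
  have trip_uniq : uniq [seq chinese p q a b | b <- Tq, a <- index_iota 1 p].
    apply: allpairs_uniq; rewrite ?iota_uniq // => -[b a] [b' a'] /=.
    case/allpairsP=> -[b1 a1] /= [bT a1p [-> ->]] /allpairsP[[b2 a2] /= [bT' a2p [-> ->]]] ab.
    have l0 : 0%N \in iota 0 r by rewrite mem_iota.
    by have [|-> -> _] := chin_inj a1 b1 0%N a2 b2 0%N a1p a2p bT bT' l0 l0; rewrite ?ab.
  apply: allpairs_uniq; rewrite ?iota_uniq // => -[j l] [j' l'] /=.
  case/allpairsP=> -[j1 l1] /= [/allpairsP[[b a] /= [bT ap ->]] lr [-> ->]].
  case/allpairsP=> -[j2 l2] /= [/allpairsP[[b' a'] /= [bT' ap' ->]] lr' [-> ->]] ab.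
  by have [-> -> ->] := chin_inj _ _ _ _ _ _ ap ap' bT bT' lr lr' ab.
set A1 := [seq q * i | i <- _]%N; set A2 := [seq p * i | i <- _]%N.
have A1P v : v \in A1 -> [/\ (q %| v)%N, ~~ (p %| v)%N & (v < p * q)%N].
  case/mapP=> i; rewrite mem_iota add1n prednK // => /andP[i0 ip] ->.
  rewrite dvdn_mulr // mulnC ltn_pmul2r // ip; split=> //.
  by rewrite mulnC Gauss_dvdr // gtnNdvd.
have A2P v : v \in A2 -> [/\ (p %| v)%N, ~~ (q %| v)%N & (v < p * q)%N].
  case/mapP=> i; rewrite mem_iota add1n prednK // => /andP[i0 iq] ->.
  rewrite dvdn_mulr // ltn_pmul2l // iq; split=> //.
  by rewrite Gauss_dvdr 1?coprime_sym // gtnNdvd.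
have s_uniq : uniq (0%N :: A1 ++ A2 ++ E3).
  rewrite /= !mem_cat !negb_or !cat_uniq E3_uniq andbT.
  rewrite !map_inj_uniq ?iota_uniq /=; last 2 first.
  - by move=> i i' /eqP; rewrite eqn_pmul2l // => /eqP.
  - by move=> i i' /eqP; rewrite eqn_pmul2l // => /eqP.
  apply/and3P; split.
  - by apply/and3P; split; apply/negP; [move/A1P|move/A2P|move/E3_cop]; rewrite !dvdn0; case.
  - apply/hasPn => v; rewrite mem_cat => /orP[/A2P[pv qv _]|/E3_cop[pv qv _]].
      by apply: contra qv => /A1P[].
    by apply: contra qv => /A1P[].
  - by apply/hasPn => v /E3_cop[pv _ _]; apply: contra pv => /A2P[].
have s_sub : {subset 0%N :: A1 ++ A2 ++ E3 <= iota 0 (p * q)}.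
  move=> v; rewrite inE !mem_cat mem_iota /= => /or4P[/eqP->|/A1P[]|/A2P[]|/E3_cop[]] //.
  by rewrite muln_gt0 p0.
(* Distinctness and inclusion suffice by counting: 1 + (p-1) + (q-1) + (p-1)(q-1) = pq, as [Tq] has
   (q-1)/r elements. *)
have [|_ eq_s] := uniq_min_size s_uniq s_sub; last by apply: uniq_perm; rewrite ?iota_uniq.
have := perm_size permq; rewrite size_iota size_allpairs size_iota => Tq_size.
rewrite /= !size_cat !size_map !size_iota !size_allpairs !size_iota.
by move: p0 q0 Tq_size; case: (p) (q) => // p' [] // q' _ _ /=; nia.
Qed.

(** * Rational numbers congruent to 1 *)

Definition local_one (p : nat) (y : rat) := exists u v : int,
  [/\ ~~ (p %| `|u|)%N, ~~ (p %| `|v|)%N, (u = v %[mod p])%Z & y = u%:~R / v%:~R].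

Lemma Fp_int_eq0 p (c : int) : prime p -> (c%:~R == 0 :> 'F_p) = (p %| `|c|)%N.
Proof. by move=> p_pr; apply: (residue_int_eq0 (idfun : {rmorphism 'F_p -> 'F_p})). Qed.

Lemma Fp_int_eq p (u v : int) : prime p -> (u = v %[mod p])%Z <-> u%:~R = v%:~R :> 'F_p.
Proof.
move=> p_pr; split=> [/eqP|/eqP].
  by rewrite eqz_mod_dvd dvdzE /= -Fp_int_eq0 // rmorphB subr_eq0 => /eqP.
by rewrite -subr_eq0 -rmorphB /= Fp_int_eq0 // => ?; apply/eqP; rewrite eqz_mod_dvd dvdzE.
Qed.

Lemma local_oneM p y y' : prime p -> local_one p y -> local_one p y' -> local_one p (y * y').
Proof.
move=> p_pr [u [v [pu pv uv ->]]] [u' [v' [pu' pv' uv' ->]]]; exists (u * u'), (v * v').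
rewrite !abszM !Euclid_dvdM // !negb_or pu pv; split=> //.
  by rewrite -modzMml uv modzMml -modzMmr uv' modzMmr.
by rewrite !rmorphM mulf_div.
Qed.

Lemma local_oneV p y : local_one p y -> local_one p y^-1.
Proof. by case=> u [v [pu pv uv ->]]; exists v, u; rewrite invf_div. Qed.

Lemma local_one_exp p q (b : int) : prime p -> prime q -> p != q ->
  q%:R ^ b = 1 :> 'F_p -> local_one p (q%:R ^ b).
Proof.
move=> p_pr q_pr pq.
have nat_exp (i : nat) : q%:R ^+ i = 1 :> 'F_p -> local_one p (q%:R ^+ i).
  move=> qi; exists (q%:Z ^+ i), 1; split=> //.
  - by rewrite abszX /= Euclid_dvdX // dvdn_prime2 // (negPf pq).
  - by rewrite dvdn1 neq_ltn prime_gt1 ?orbT.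
  - by apply/Fp_int_eq => //; rewrite rmorphXn /= qi.
  - by rewrite rmorphXn /= divr1.
case: b => i; first exact: nat_exp.
rewrite NegzE -!exprnN => qi; apply/local_oneV/nat_exp.
by apply: invr_inj; rewrite qi invr1.
Qed.

Lemma local_one_num_den p (y : rat) : prime p -> local_one p y ->
  [/\ coprime `|numq y| p, coprime `|denq y| p & (numq y = denq y %[mod p])%Z].
Proof.
move=> p_pr [u [v [pu pv uv yE]]].
have v0 : v != 0 by apply: contraNneq pv => ->.
have uv_eq : numq y * v = u * denq y.
  apply/eqP; rewrite -(eqr_int rat) !rmorphM /= -eqr_div ?intr_eq0 ?denq_neq0 //.
  by rewrite divq_num_den yE.
have n_v : (numq y)%:~R * v%:~R = u%:~R * (denq y)%:~R :> 'F_p by rewrite -!rmorphM /= uv_eq.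
have u0 : u%:~R != 0 :> 'F_p by rewrite Fp_int_eq0.
have eq_nd : (numq y)%:~R = (denq y)%:~R :> 'F_p.
  by apply: (mulIf u0); rewrite [RHS]mulrC -n_v (Fp_int_eq u v p_pr).1.
have d0 : ~~ (p %| `|denq y|)%N.
  apply/negP => pd; move: (pd); rewrite -Fp_int_eq0 // -eq_nd Fp_int_eq0 // => pn.
  have := coprime_num_den y; rewrite /coprime => /eqP g1.
  have : (p %| gcdn `|numq y| `|denq y|)%N by rewrite dvdn_gcd pn.
  by rewrite g1 dvdn1 => /eqP p1; move: p_pr; rewrite p1.
rewrite ![coprime _ p]coprime_sym !prime_coprime //; split=> //.
  by rewrite -Fp_int_eq0 // eq_nd Fp_int_eq0.
exact/Fp_int_eq.
Qed.

Lemma local_one_eq1_mod p q (y : rat) : prime p -> prime q -> p != q ->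
  local_one p y -> local_one q y -> rat_eq1_mod y (p * q).
Proof.
move=> p_pr q_pr pq /(local_one_num_den p_pr)[np dp ndp] /(local_one_num_den q_pr)[nq dq ndq].
rewrite /rat_eq1_mod !coprimezE !absz_nat !coprimeMr np nq dp dq; split=> //.
apply/eqP; rewrite eqz_mod_dvd dvdzE absz_nat Gauss_dvd; last first.
  by rewrite prime_coprime // dvdn_prime2.
by apply/andP; split; rewrite -[X in (X %| _)%N]absz_nat -dvdzE -eqz_mod_dvd; apply/eqP.
Qed.

(** * Embeddings of number fields *)

Lemma rmorph_horner_rat (K : fieldExtType rat) (L : fieldType)
    (f : {rmorphism K -> L}) (s : {poly rat}) x :
  f (map_poly (in_alg K) s).[x] = (map_poly ratr s).[f x].
Proof.
rewrite -horner_map -map_poly_comp; congr (_.[_]); apply: eq_map_poly => a /=.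
exact: (fmorph_eq_rat (f \o in_alg K)).
Qed.

Lemma num_field_generator (K : fieldExtType rat) : exists x : K,
  forall y, exists s : {poly rat}, y = (map_poly (in_alg K) s).[x].
Proof.
have sepK : separable 1 {:K}.
  apply/separableP => y _; apply: pcharf0_separable => p.
  by rewrite (fmorph_pchar (in_alg K)) Num.Theory.pchar_num.
have KE := eq_adjoin_separable_generator sepK (sub1v _).
exists (separable_generator 1 {:K}) => y.
have : y \in {:K}%VS by apply: memvf.
rewrite {1}KE => /Fadjoin_polyP[s /polyOver1P[t ->] ->].
by exists t.
Qed.

(** A primitive element x is sent to a root w of its minimal polynomial; [fE] says that the image
    does not depend on the polynomial in x chosen to represent y. *)
Lemma num_field_embedding (K : fieldExtType rat) : exists f : {rmorphism K -> algC}, True.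
Proof.
have [x xP] := num_field_generator K; have [s sP] := choice xP.
have [m mE] := polyOver1P (minPolyOver 1 x).
have [w mw] : exists w : algC, root (map_poly ratr m) w.
  apply/closed_rootP; rewrite size_map_poly -(size_map_poly (in_alg K)) /= -mE.
  by rewrite size_minPoly.
pose f y := (map_poly ratr (s y)).[w].
have fE y t : y = (map_poly (in_alg K) t).[x] -> f y = (map_poly ratr t).[w].
  move=> yE; apply/eqP; rewrite -subr_eq0 -hornerN -hornerD -rmorphB /=.
  have : m %| s y - t.
    rewrite -(dvdp_map (in_alg K)) /= -mE; apply: minPoly_dvdp.
      by apply/polyOver1P; eexists.
    by rewrite rootE rmorphB /= hornerD hornerN -sP -yE subrr.
  by case/dvdpP=> u ->; rewrite rmorphM /= hornerM (eqP mw) mulr0.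
have f_add : zmod_morphism f.
  move=> y y'; rewrite (fE _ (s y - s y')); last by rewrite rmorphB /= hornerD hornerN -!sP.
  by rewrite rmorphB /= hornerD hornerN.
have f_mul : monoid_morphism f.
  split; first by rewrite (fE _ 1) ?rmorph1 ?hornerC.
  move=> y y'; rewrite (fE _ (s y * s y')); last by rewrite rmorphM /= hornerM -!sP.
  by rewrite rmorphM /= hornerM.
pose fA := GRing.isZmodMorphism.Build _ _ f f_add.
pose fM := GRing.isMonoidMorphism.Build _ _ f f_mul.
pose g : {rmorphism K -> algC} := HB.pack f fA fM.
by exists g.
Qed.

Section Restriction.
Variables (F : splittingFieldType rat) (iota : {rmorphism F -> algC}).
Hypothesis F_gal : galois 1 {:F}.

(** The minimal polynomial of a generator splits in F into Galois conjugates, so f sends the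
    generator to [iota] of one of them. With j the identity this restricts automorphisms of [algC]
    to F; with j an inclusion it lists the embeddings of a subfield. *)
Lemma embedding_gal (K : fieldExtType rat) (j : {rmorphism K -> F})
    (f : {rmorphism K -> algC}) :
  exists g : gal_of {:F}, forall y, f y = iota (g (j y)).
Proof.
have [x xP] := num_field_generator K.
have [m mE] := polyOver1P (minPolyOver 1 (j x)).
have /(galois_factors (sub1v _))/(_ (j x) (memvf _))[r [_ _ rE]] := F_gal.
have mx : (map_poly (in_alg K) m).[x] = 0.
  apply: (fmorph_inj j); rewrite rmorph0 rmorph_horner_rat.
  rewrite -[RHS](minPolyxx 1 (j x)) mE; congr (_.[_]); apply: eq_map_poly => a.
  exact/esym/(fmorph_eq_rat (in_alg F)).
have : root (map_poly iota (minPoly 1 (j x))) (f x).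
  rewrite mE -map_poly_comp (eq_map_poly (g := ratr)).
    by rewrite rootE -rmorph_horner_rat mx rmorph0.
  by move=> a /=; apply: (fmorph_eq_rat (iota \o in_alg F)).
rewrite rE rmorph_prod /= rootE horner_prod prodf_seq_eq0 => /hasP[_ /mapP[g _ ->]].
rewrite /= map_polyXsubC hornerXsubC subr_eq0 => /eqP fx; exists g => y.
have [s ->] := xP y; rewrite !rmorph_horner_rat fx.
rewrite -(rmorph_horner_rat (iota \o (g : {rmorphism F -> F}))) /=; congr (iota (g _)).
congr (_.[_]); apply: eq_map_poly => a /=.
exact: (fmorph_eq_rat (in_alg F)).
Qed.

Lemma restriction_exists : exists res : absgal -> gal_of {:F},
  forall (s : absgal) x, s (iota x) = iota (res s x).
Proof.
have /choice[res resE] : forall s : absgal, exists g : gal_of {:F},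
    forall x, s (iota x) = iota (g x).
  by move=> s; have [g gE] := embedding_gal idfun (s \o iota); exists g.
by exists res.
Qed.

Lemma lift_exists : exists lift : gal_of {:F} -> absgal, galois_lift iota lift.
Proof.
have /choice[lift liftE] : forall g : gal_of {:F}, exists s : absgal,
    forall x, s (iota x) = iota (g x).
  by move=> g; have [s sE] := extend_algC_subfield_aut iota g; exists s => x; rewrite sE.
by exists lift.
Qed.

Variable res : absgal -> gal_of {:F}.
Hypothesis resE : forall (s : absgal) x, s (iota x) = iota (res s x).

Lemma gal_iota_eq (g h : gal_of {:F}) : (forall x, iota (g x) = iota (h x)) -> g = h.
Proof. by move=> gh; apply/eqP/gal_eqP => x _; apply: (fmorph_inj iota). Qed.

(** The order is reversed because the product in [gal_of] composes from left to right; the same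
    reversal shapes the law of [beta] and [mu]. *)
Lemma res_comp (s t u : absgal) : u =1 s \o t -> res u = (res t * res s)%g.
Proof.
by move=> ust; apply: gal_iota_eq => x; rewrite -resE ust /= !resE galM ?memvf.
Qed.

Lemma res_fixes s : fixes iota s -> res s = 1%g.
Proof. by move=> sP; apply: gal_iota_eq => x; rewrite -resE sP gal_id. Qed.

Lemma res_cont : exists l : seq algC, forall s : absgal, {in l, s =1 id} -> res s = 1%g.
Proof.
have [x xP] := num_field_generator F; exists [:: iota x] => s sx.
apply: res_fixes => y; have [t ->] := xP y.
have /= -> := rmorph_horner_rat (s \o iota) t x.
by rewrite sx ?mem_head // -rmorph_horner_rat.
Qed.

End Restriction.

(** * Permutation and monomial representations *)

Lemma perm_action_unit (A : comUnitRingType) n (pi : 'I_n -> 'I_n) : injective pi ->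
  (\matrix_(i, k) (i == pi k)%:R : 'M[A]_n) \in unitmx.
Proof.
move=> pi_inj; have -> : \matrix_(i, k) (i == pi k)%:R = (perm_mx (perm pi_inj))^T :> 'M[A]_n.
  by apply/matrixP => i k; rewrite !mxE permE eq_sym.
by rewrite unitmx_tr unitmx_perm.
Qed.

Lemma ind_triv_exists (R : realType) (K : fieldExtType rat) n
    (e : 'I_n -> {rmorphism K -> algC}) :
  (forall i k, e i =1 e k -> i = k) ->
  (forall f : {rmorphism K -> algC}, exists i, f =1 e i) ->
  exists rho : artin_rep R n, is_ind_triv K rho /\
    forall s i k, rho s i k = (`[< e i =1 s \o e k >] : nat)%:R.
Proof.
move=> e_inj e_all.
have /choice[pi piP] : forall s : absgal, exists pi : 'I_n -> 'I_n, forall k, s \o e k =1 e (pi k).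
  move=> s; have /choice[pi piP] : forall k, exists i, s \o e k =1 e i.
    by move=> k; apply: e_all.
  by exists pi.
pose D (s : absgal) : 'M[R[i]]_n := \matrix_(i, k) (i == pi s k)%:R.
have piE (s : absgal) i k : e i =1 s \o e k -> i = pi s k.
  by move=> ik; apply: e_inj => x; rewrite ik piP.
have D_unit s : D s \in unitmx.
  apply: perm_action_unit => k k' kk'; apply: e_inj => x; apply: (fmorph_inj s).
  by have := piP s k x; rewrite kk' -piP.
have D_mul (s t u : absgal) : u =1 s \o t -> D u = D s *m D t.
  move=> ust; apply/matrixP => i k; rewrite !mxE (bigD1 (pi t k)) //= !mxE eqxx mulr1.
  rewrite big1 => [|l /negPf lk]; last by rewrite !mxE lk mulr0.
  rewrite addr0; congr ((i == _)%:R); apply/esym/piE => x.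
  by rewrite -piP /= -piP /= ust.
have D_cont : exists l : seq algC, forall s : absgal, {in l, s =1 id} -> D s = 1%:M.
  have [x xP] := num_field_generator K; exists [seq e k x | k <- enum 'I_n] => s sx.
  apply/matrixP => i k; rewrite !mxE; congr ((i == _)%:R); apply/esym/piE => y.
  have [t ->] := xP y; have /= -> := rmorph_horner_rat (s \o e k) t x.
  rewrite sx -?rmorph_horner_rat //.
  by apply: (map_f (fun k => e k x)); rewrite mem_enum.
suff DE s i k : D s i k = (`[< e i =1 s \o e k >] : nat)%:R.
  by exists (ArtinRep D_unit D_mul D_cont); split=> //; exists e.
rewrite mxE.
suff -> : (i == pi s k) = `[< e i =1 s \o e k >] by [].
by apply/eqP/asboolP => [-> x|]; [rewrite piP | apply: piE].
Qed.

Section Intertwiners.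
Variables (R : realType) (B : forall n, artin_rep R n -> R[i]).
Hypothesis B_iso : forall n (rho tau : artin_rep R n), aiso rho tau -> B rho = B tau.

(** [B_iso] compares representations in one and the same dimension; rectangular mutually inverse
    intertwiners also serve for dimensions that are only provably equal. *)
Lemma B_intertwiner n m (rho : artin_rep R n) (tau : artin_rep R m)
    (T : 'M[R[i]]_(n, m)) (T' : 'M[R[i]]_(m, n)) :
  T *m T' = 1%:M -> T' *m T = 1%:M -> (forall s, rho s *m T = T *m tau s) ->
  B rho = B tau.
Proof.
move=> TT' T'T; have nm : n = m.
  by apply/eqP; rewrite eqn_leq (mulmx1_min TT') (mulmx1_min T'T).
case: _ / nm tau T T' TT' T'T => tau T T' TT' _ rhoT.
by apply: B_iso; exists T => //; case/mulmx1_unit: TT'.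
Qed.

End Intertwiners.

Lemma mulmx1_eq_dim (A : comUnitRingType) n m
    (S : 'M[A]_(n, m)) (S' : 'M[A]_(m, n)) :
  n = m -> S *m S' = 1%:M -> S' *m S = 1%:M.
Proof. by move=> nm; case: _ / nm S S' => S S' /mulmx1C. Qed.

(* s acts on indices modulo d | n by i |-> i k^(beta s) + mu s, as res s = c^(beta s)
   x^(mu s) does on the cosets of a subgroup containing c; [monomial j] is induced
   from the character x^m |-> z^(j m), in the basis of its conjugates by powers of c. *)
Section Monomial.
Variables (R : realType) (n r k : nat) (z : R[i]) (beta mu : absgal -> nat).
Local Notation C := R[i].
Hypotheses (z_prim : n.-primitive_root z) (r_gt0 : (0 < r)%N) (kr : (k ^ r = 1 %[mod n])%N).
Hypothesis act_mul : forall s t u : absgal, u =1 s \o t ->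
  (beta u = beta t + beta s %[mod r])%N /\ (mu u = mu t * k ^ beta s + mu s %[mod n])%N.
Hypothesis act_cont : exists l : seq algC, forall s : absgal, {in l, s =1 id} ->
  (beta s = 0 %[mod r])%N /\ (mu s = 0 %[mod n])%N.

Lemma expn_mod_order a b : (a = b %[mod r])%N -> (k ^ a = k ^ b %[mod n])%N.
Proof.
move=> ab; suff kmod c : (k ^ c = k ^ (c %% r) %[mod n])%N by rewrite kmod ab -kmod.
have krq q : (k ^ (q * r) = 1 %[mod n])%N.
  by rewrite mulnC expnM -modnXm kr modnXm exp1n.
by rewrite {1}(divn_eq c r) expnD -modnMml krq modnMml mul1n.
Qed.

Lemma root_expr_mod a b : (a = b %[mod n])%N -> z ^+ a = z ^+ b.
Proof. by move=> ab; apply/eqP; rewrite (eq_prim_root_expr z_prim) ab. Qed.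

Definition shift (b : nat) (l : 'I_r) : 'I_r := Ordinal (ltn_pmod (l + b) r_gt0).

Lemma shift_inj b : injective (shift b).
Proof.
move=> l l' /(congr1 val)/eqP /=; rewrite eqn_modDr !modn_small // => /eqP.
exact: val_inj.
Qed.

Section Twist.
Variable j : nat.

Definition monomial_mx (s : absgal) : 'M[C]_r :=
  \matrix_(l, l') (z ^+ (j * k ^ l * mu s) * (l' == shift (beta s) l)%:R).

Lemma monomial_unit s : monomial_mx s \in unitmx.
Proof.
have -> : monomial_mx s =
    diag_mx (\row_l z ^+ (j * k ^ l * mu s)) *m (\matrix_(i, i') (i == shift (beta s) i')%:R)^T.
  by apply/matrixP => l l'; rewrite mul_diag_mx !mxE.
rewrite unitmx_mul unitmx_tr perm_action_unit ?andbT; last exact: shift_inj.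
rewrite unitmxE det_diag unitfE prodf_seq_neq0; apply/allP => l _.
by rewrite mxE expf_neq0 // (prim_root_eq0 z_prim) -lt0n (prim_order_gt0 z_prim).
Qed.

Lemma monomial_mul (s t u : absgal) : u =1 s \o t ->
  monomial_mx u = monomial_mx s *m monomial_mx t.
Proof.
move=> /act_mul[bu mu_u]; apply/matrixP => l l''.
rewrite !mxE (bigD1 (shift (beta s) l)) //= !mxE eqxx mulr1.
rewrite big1 => [|l' /negPf ll']; last by rewrite !mxE ll' mulr0 mul0r.
have -> : shift (beta u) l = shift (beta t) (shift (beta s) l).
  apply/val_inj; rewrite /= -modnDmr bu modnDmr modnDml.
  by congr (_ %% r)%N; rewrite -addnA [(beta s + _)%N]addnC.
rewrite addr0 mulrA -exprD; congr (_ * _); apply: root_expr_mod.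
have kE : (k ^ shift (beta s) l = k ^ l * k ^ beta s %[mod n])%N.
  by rewrite -expnD; apply: expn_mod_order; rewrite /= modn_mod.
rewrite -modnMmr mu_u modnMmr mulnDr addnC -modnDmr -[RHS]modnDmr; congr ((_ + _) %% n)%N.
by rewrite [in RHS]mulnAC -[RHS]modnMmr kE modnMmr mulnACA.
Qed.

Lemma monomial_id s : (beta s = 0 %[mod r])%N -> (mu s = 0 %[mod n])%N ->
  monomial_mx s = 1%:M.
Proof.
move=> b0 m0; apply/matrixP => i i'; rewrite !mxE; have -> : shift (beta s) i = i.
  by apply/val_inj; rewrite /= -modnDmr b0 mod0n addn0 modn_small.
rewrite (@root_expr_mod _ 0) ?expr0 ?mul1r 1?eq_sym //.
by rewrite -modnMmr m0 mod0n muln0 mod0n.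
Qed.

Lemma monomial_cont : exists l : seq algC, forall s : absgal, {in l, s =1 id} ->
  monomial_mx s = 1%:M.
Proof. by have [l lP] := act_cont; exists l => s /lP[]; apply: monomial_id. Qed.

Definition monomial : artin_rep R r := ArtinRep monomial_unit monomial_mul monomial_cont.

End Twist.

(** A polynomial independent of j, so that the traces of [monomial j] appear as the conjugates under
    z -> z^j of those of [monomial 1]. *)
Definition monomial_trace_poly (b m : nat) : {poly rat} :=
  \sum_(l < r | l == shift b l) 'X^(k ^ l * m).

Lemma monomial_trace j s : \tr (monomial j s) =
  (map_poly ratr (monomial_trace_poly (beta s) (mu s))).[z ^+ j].
Proof.
rewrite rmorph_sum /= horner_sum [RHS]big_mkcond; apply: eq_bigr => l _.
rewrite mxE map_polyXn hornerXn -exprM mulnA.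
by case: eqP => _; rewrite ?mulr1 ?mulr0.
Qed.

(** Multiplying [mu] by a conjugates the trace: the conjugate is a value of the same character at
    another element, which makes the character field stable under z -> z^a. *)
Lemma monomial_trace_conj a s s' :
  (beta s' = beta s %[mod r])%N -> (mu s' = a * mu s %[mod n])%N ->
  \tr (monomial 1 s') = (map_poly ratr (monomial_trace_poly (beta s) (mu s))).[z ^+ a].
Proof.
move=> b' m'; rewrite -monomial_trace; apply: eq_bigr => l _; rewrite !mxE.
have -> : shift (beta s') l = shift (beta s) l.
  by apply/val_inj; rewrite /= -modnDmr b' modnDmr.
congr (_ * _); apply: root_expr_mod.
by rewrite mul1n -modnMmr m' modnMmr mulnCA mulnA.
Qed.

(** * Fourier transform on Z/d *)

Section Fourier.
Variable B : forall m, artin_rep R m -> C.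
Hypothesis B_iso : forall m (rho tau : artin_rep R m), aiso rho tau -> B rho = B tau.
Hypothesis B_sum : forall m m' (rho : artin_rep R m) (tau : artin_rep R m'),
  B (asum rho tau) = B rho * B tau.

Lemma trivial_unit (s : absgal) : 1%:M \in @unitmx C 1.
Proof. exact: unitmx1. Qed.

Lemma trivial_mul (s t u : absgal) : u =1 s \o t -> 1%:M = 1%:M *m 1%:M :> 'M[C]_1.
Proof. by rewrite mulmx1. Qed.

Lemma trivial_cont : exists l : seq algC, forall s : absgal, {in l, s =1 id} ->
  1%:M = 1%:M :> 'M[C]_1.
Proof. by exists [::]. Qed.

Definition trivial_rep : artin_rep R 1 :=
  @ArtinRep R 1 (fun=> 1%:M) trivial_unit trivial_mul trivial_cont.

Definition monomial_dim (js : seq nat) := foldr (fun _ m => r + m)%N 1%N js.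

Fixpoint monomial_sum (js : seq nat) : artin_rep R (monomial_dim js) :=
  if js is j :: js' then asum (monomial j) (monomial_sum js') else trivial_rep.

Lemma B_monomial_sum js :
  B (monomial_sum js) = B trivial_rep * \prod_(j <- js) B (monomial j).
Proof.
elim: js => [|j js IH] /=; first by rewrite big_nil mulr1.
by rewrite B_sum IH big_cons mulrCA.
Qed.

Variables (d : nat) (rho : artin_rep R d).
Hypothesis d_n : (d %| n)%N.
Hypothesis rhoE : forall s (i i' : 'I_d),
  rho s i i' = (i == i' * k ^ beta s + mu s %[mod d])%:R.

(** The rows are characters of Z/d, grouped in orbits under k in the order of the blocks of
    [monomial_sum], with the trivial character last. *)
Fixpoint fourier_mx (js : seq nat) : 'M[C]_(monomial_dim js, d) :=
  if js is j :: js' then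
    col_mx (\matrix_(l, i) z ^+ (j * k ^ l * i)) (fourier_mx js')
  else const_mx 1.

Fixpoint fourier_inv (js : seq nat) : 'M[C]_(d, monomial_dim js) :=
  if js is j :: js' then
    row_mx (\matrix_(i, l) (d%:R^-1 * z ^- (j * k ^ l * i))) (fourier_inv js')
  else const_mx d%:R^-1.

Let d_gt0 : (0 < d)%N.
Proof. by rewrite (dvdn_gt0 _ d_n) // (prim_order_gt0 z_prim). Qed.

Lemma root_expr_periodic j a b : (n %/ d %| j)%N -> (a = b %[mod d])%N ->
  z ^+ (j * a) = z ^+ (j * b).
Proof.
move=> /dvdnP[j' ->] ab; apply: root_expr_mod.
rewrite -!mulnA -modnMmr -[RHS]modnMmr; congr (_ * _ %% _)%N.
by rewrite -{2 4}(divnK d_n) -!muln_modr ab.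
Qed.

(** At the index i k^(beta s) + mu s, the character of row l is z^(j k^l mu s) times the character
    of row [shift (beta s) l] at i: exactly the entry of the monomial matrix. Divisibility of j by
    n/d makes the characters well defined mod d. *)
Lemma fourier_intertwiner js s : all (dvdn (n %/ d)) js ->
  fourier_mx js *m rho s = monomial_sum js s *m fourier_mx js.
Proof.
have pick_i (i : 'I_d) (y : 'I_d -> C) :
    \sum_i' y i' * rho s i' i = y (Ordinal (ltn_pmod (i * k ^ beta s + mu s) d_gt0)).
  rewrite (bigD1 (Ordinal (ltn_pmod (i * k ^ beta s + mu s) d_gt0))) //= rhoE.
  rewrite /= modn_mod eqxx mulr1 big1 ?addr0 // => i' ii'.
  rewrite rhoE; case: eqP => [ii|]; last by rewrite mulr0.
  by case/eqP: ii'; apply/val_inj; rewrite /= -ii modn_small.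
elim: js => [|j js IH] /=.
  move=> _; rewrite mul1mx; apply/matrixP => l i; rewrite !mxE.
  by under eq_bigr do rewrite mxE; apply: (pick_i i (fun=> 1)).
case/andP=> jd /IH {}IH; rewrite mul_col_mx IH /asum_mx mul_block_col !mul0mx addr0 add0r.
congr col_mx; apply/matrixP => l i; rewrite !mxE.
under eq_bigr do rewrite mxE; rewrite (pick_i i (fun i' => z ^+ (j * k ^ l * i'))) /=.
rewrite (bigD1 (shift (beta s) l)) //= big1 ?addr0 => [|l' /negPf ll']; last first.
  by rewrite !mxE ll' mulr0 mul0r.
rewrite !mxE eqxx mulr1 -exprD (@root_expr_periodic _ _ (i * k ^ beta s + mu s)).
- apply: root_expr_mod; rewrite mulnDr addnC -modnDmr -[RHS]modnDmr.
  have kE : (k ^ shift (beta s) l = k ^ l * k ^ beta s %[mod n])%N.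
    by rewrite -expnD; apply: expn_mod_order; rewrite /= modn_mod.
  congr ((_ + _) %% n)%N; rewrite [in RHS]mulnAC -[RHS]modnMmr kE modnMmr.
  by rewrite mulnACA.
- by rewrite dvdn_mulr.
- by rewrite modn_mod.
Qed.

(** Orthogonality of characters: the hypothesis lists every character of Z/d once, and an
    off-diagonal entry is a full geometric sum of a nontrivial d-th root of unity. *)
Lemma fourier_invK js :
  perm_eq (0%N :: [seq (j * k ^ l %% n)%N | j <- js, l <- iota 0 r])
          [seq (n %/ d * t)%N | t <- iota 0 d] ->
  fourier_inv js *m fourier_mx js = 1%:M.
Proof.
move=> js_perm; pose w := z ^+ (n %/ d).
have w_prim : d.-primitive_root w by apply: dvdn_prim_root.
pose y i' i c := d%:R^-1 * z ^- (c * i') * z ^+ (c * i) : C.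
have entryE (i' i : 'I_d) : (fourier_inv js *m fourier_mx js) i' i =
    y i' i 0%N + \sum_(j <- js) \sum_(0 <= l < r) y i' i (j * k ^ l %% n)%N.
  elim: {js_perm} js => [|j js IH] /=.
    by rewrite big_nil addr0 mxE big_ord1 !mxE /y !mul0n expr0 invr1 !mulr1.
  rewrite mul_row_col mxE IH big_cons addrCA; congr (_ + (_ + _)); rewrite mxE big_mkord.
  apply: eq_bigr => l _; rewrite !mxE /y.
  have zm x : z ^+ (j * k ^ l %% n * x) = z ^+ (j * k ^ l * x).
    by apply: root_expr_mod; rewrite modnMml.
  by rewrite !zm.
apply/matrixP => i' i; rewrite entryE mxE.
have -> : y i' i 0%N + \sum_(j <- js) \sum_(0 <= l < r) y i' i (j * k ^ l %% n)%N =
    \sum_(c <- 0%N :: [seq (j * k ^ l %% n)%N | j <- js, l <- iota 0 r]) y i' i c.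
  by rewrite big_cons big_allpairs_dep /index_iota subn0.
rewrite (perm_big _ js_perm) big_map /=.
have yE t : y i' i (n %/ d * t)%N = d%:R^-1 * (w ^+ i / w ^+ i') ^+ t.
  rewrite /y /w -mulrA; congr (_ * _).
  by rewrite expr_div_n -!exprM mulrC -!mulnA ![(t * _)%N]mulnC.
rewrite (eq_bigr _ (fun t _ => yE t)) -mulr_sumr.
have w0 : w != 0 by rewrite (prim_root_eq0 w_prim) -lt0n.
have [->|ii'] := eqVneq i' i.
  rewrite (divff (expf_neq0 _ w0)). under eq_bigr do rewrite expr1n.
  by rewrite big_const_seq count_predT size_iota iter_addr addr0 mulVf // pnatr_eq0 -lt0n.
have u1 : w ^+ i / w ^+ i' - 1 != 0.
  rewrite subr_eq0; apply: contra ii' => /eqP/divr1_eq/eqP.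
  by rewrite (eq_prim_root_expr w_prim) !modn_small // eq_sym.
suff -> : \sum_(t <- iota 0 d) (w ^+ i / w ^+ i') ^+ t = 0 by rewrite mulr0.
apply: (mulfI u1); rewrite mulr0 -[d in iota 0 d]subn0 -/(index_iota 0 d) big_mkord -subrX1.
by rewrite expr_div_n -!exprM ![(_ * d)%N]mulnC !exprM (prim_expr_order w_prim) !expr1n divr1 subrr.
Qed.

Lemma B_permutation js :
  perm_eq (0%N :: [seq (j * k ^ l %% n)%N | j <- js, l <- iota 0 r])
          [seq (n %/ d * t)%N | t <- iota 0 d] ->
  all (dvdn (n %/ d)) js ->
  B rho = B trivial_rep * \prod_(j <- js) B (monomial j).
Proof.
move=> js_perm js_dvd; rewrite -B_monomial_sum.
have dimE : d = monomial_dim js.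
  have := perm_size js_perm; rewrite size_map size_iota /= => <-.
  by elim: (js) => //= j js' IH; rewrite size_cat size_map size_iota -addnS IH.
have inv1 := fourier_invK js_perm; have inv2 := mulmx1_eq_dim dimE inv1.
apply: (B_intertwiner B_iso (T := fourier_inv js) (T' := fourier_mx js)) => // s.
rewrite -[rho s]mul1mx -inv1 -(mulmxA (fourier_inv js)) (fourier_intertwiner _ js_dvd).
by rewrite !mulmxA -mulmxA inv2 mulmx1.
Qed.

End Fourier.

End Monomial.

(** * Metacyclic groups and their fixed fields *)

Section Metacyclic.
Variables (gT : finGroupType) (x c : gT) (k : nat).
Hypotheses (xc : (x ^ c = x ^+ k)%g) (xIc : (<[x]> :&: <[c]> = 1)%g).
Local Open Scope group_scope.

Lemma metacyclic_conj i b : (x ^+ i) ^ (c ^+ b) = x ^+ (i * k ^ b).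
Proof.
elim: b => [|b IH]; first by rewrite conjg1 muln1.
by rewrite expgSr conjgM IH conjXg xc -expgM expnS mulnCA.
Qed.

Lemma metacyclic_swap i b : x ^+ i * c ^+ b = c ^+ b * x ^+ (i * k ^ b).
Proof. by rewrite conjgC metacyclic_conj. Qed.

Lemma metacyclic_mul b m b' m' :
  c ^+ b * x ^+ m * (c ^+ b' * x ^+ m') = c ^+ (b + b') * x ^+ (m * k ^ b' + m').
Proof. by rewrite !expgD !mulgA -(mulgA (c ^+ b) (x ^+ m)) metacyclic_swap !mulgA. Qed.

Lemma metacyclic_inj b m b' m' : c ^+ b * x ^+ m = c ^+ b' * x ^+ m' ->
  (b = b' %[mod #[c]%g])%N /\ (m = m' %[mod #[x]%g])%N.
Proof.
move=> bm; have e1 : (c ^+ b')^-1 * c ^+ b = x ^+ m' * (x ^+ m)^-1.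
  by rewrite -(mulgK (x ^+ m) (c ^+ b)) bm -mulgA mulKg.
have : (c ^+ b')^-1 * c ^+ b \in <[x]> :&: <[c]>.
  by rewrite inE {1}e1 !groupM ?groupV ?mem_cycle.
rewrite xIc => /set1gP c1; split; apply/eqP.
  rewrite -(eq_expg_mod_order c); apply/eqP.
  by apply: (mulgI (c ^+ b')^-1); rewrite c1 mulVg.
rewrite -(eq_expg_mod_order x); apply/eqP/esym.
by apply: (mulIg (x ^+ m)^-1); rewrite -e1 c1 mulgV.
Qed.

End Metacyclic.

Lemma gal_full (F : splittingFieldType rat) (g : gal_of {:F}) : g \in 'Gal({:F} / 1)%g.
Proof. by rewrite gal_kHom ?sub1v ?k1AHom.
Qed.

Section Embeddings.
Variables (F : splittingFieldType rat) (iota : {rmorphism F -> algC}).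
Hypothesis F_gal : galois 1 {:F}.
Variables (x c : gal_of {:F}) (k : nat).
Hypotheses (xc : (x ^ c = x ^+ k)%g) (xIc : (<[x]> :&: <[c]> = 1)%g).
Hypothesis gen : forall g : gal_of {:F}, exists b m, g = (c ^+ b * x ^+ m)%g.

Lemma action_exists : exists beta mu : absgal -> nat, forall (s : absgal) y,
  s (iota y) = iota ((c ^+ beta s * x ^+ mu s)%g y).
Proof.
have [res resE] := restriction_exists iota F_gal.
have /choice[bm bmE] : forall s : absgal, exists bm : nat * nat,
    res s = (c ^+ bm.1 * x ^+ bm.2)%g.
  by move=> s; have [b [m ->]] := gen (res s); exists (b, m).
by exists (fst \o bm), (snd \o bm) => s y; rewrite /= -bmE.
Qed.

Variables (beta mu : absgal -> nat).
Hypothesis actE : forall (s : absgal) y, s (iota y) = iota ((c ^+ beta s * x ^+ mu s)%g y).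

Lemma action_mul (s t u : absgal) : u =1 s \o t ->
  (beta u = beta t + beta s %[mod #[c]%g])%N /\
  (mu u = mu t * k ^ beta s + mu s %[mod #[x]%g])%N.
Proof.
move=> /(res_comp actE); rewrite (metacyclic_mul xc).
exact: metacyclic_inj.
Qed.

Lemma action_fixes (s : absgal) : fixes iota s ->
  (beta s = 0 %[mod #[c]%g])%N /\ (mu s = 0 %[mod #[x]%g])%N.
Proof.
move=> /(res_fixes actE) s1; apply: (metacyclic_inj xIc).
by rewrite s1 mulg1.
Qed.

Lemma action_cont : exists l : seq algC, forall s : absgal, {in l, s =1 id} ->
  (beta s = 0 %[mod #[c]%g])%N /\ (mu s = 0 %[mod #[x]%g])%N.
Proof.
have [l lP] := res_cont actE; exists l => s /lP s1; apply: (metacyclic_inj xIc).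
by rewrite s1 mulg1.
Qed.

Variables (R : realType) (H : {group gal_of {:F}}) (d : nat).
Hypotheses (d_gt0 : (0 < d)%N) (cH : c \in H).
Hypothesis xH : forall i, (x ^+ i \in H)%g = (d %| i)%N.

Lemma fixedField_coset (g h : gal_of {:F}) :
  (forall v : subvs_of (fixedField H), g (vsval v) = h (vsval v)) <-> (g * h^-1)%g \in H.
Proof.
split=> [gh|ghH v]; last first.
  have /fixedFieldP-/(_ (memvf _) _ ghH) vE : vsval v \in fixedField H by apply: subvsP.
  by rewrite -[in RHS]vE -galM ?memvf // mulgKV.
rewrite -(gal_fixedField H) gal_kHom ?fixedField_bound //.
apply/kAHomP => y yH; rewrite galM ?memvf //.
have := gh (Subvs yH); rewrite /= => ->.
by rewrite -galM ?memvf // mulgV gal_id.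
Qed.

(** Since c lies in H, the coset of c^b x^m is that of x^m and depends only on m mod d; hence the
    embeddings [iota] after x^i, i < d, are all of them. Moving x^i' past c^(beta s) gives the
    action on indices. *)
Lemma fixedField_embeddings : exists rho : artin_rep R d,
  is_ind_triv (subvs_of (fixedField H)) rho /\
  forall s (i i' : 'I_d), rho s i i' = (i == i' * k ^ beta s + mu s %[mod d])%:R.
Proof.
pose e (i : 'I_d) : {rmorphism subvs_of (fixedField H) -> algC} :=
  iota \o (x ^+ i)%g \o vsval.
have cosetE i b m :
    ((x ^+ i * (c ^+ b * x ^+ m)^-1)%g \in H) = (i == m %[mod d])%N.
  rewrite invMg mulgA groupMr ?groupV ?groupX //.
  have x_m : ((x ^+ m)^-1 = x ^+ (m * #[x].-1))%g.
    apply/eqP; rewrite eq_invg_mul -expgD -mulnS prednK ?order_gt0 // mulnC expgM expg_order.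
    by rewrite expg1n.
  rewrite x_m -expgD xH.
  have dx : (d %| #[x]%g)%N by rewrite -xH expg_order group1.
  rewrite -(eqn_modDr (m * #[x]%g.-1)).
  have /eqP-> : (m + m * #[x]%g.-1 == 0 %[mod d])%N.
    by rewrite -mulnS prednK ?order_gt0 // mod0n -/(dvdn _ _) dvdn_mull.
  by rewrite mod0n.
have eE (f : {rmorphism subvs_of (fixedField H) -> algC}) i b m :
    (forall v, f v = iota ((c ^+ b * x ^+ m)%g (vsval v))) ->
    e i =1 f <-> (i == m %[mod d])%N.
  move=> fE; rewrite -(cosetE i b m); split=> [ef|/fixedField_coset gh v].
    by apply/fixedField_coset => v; apply: (fmorph_inj iota); rewrite -fE -ef.
  by rewrite fE -gh.
have [||rho [rho_ind rhoE]] := @ind_triv_exists R _ _ e.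
- move=> i i' ii'; apply/val_inj/eqP.
  have/(eE (e i') i 0%N i') : e i =1 e i' by [].
  by rewrite !modn_small //; apply=> v; rewrite mul1g.
- move=> f; have [g gE] := embedding_gal iota F_gal vsval f.
  have [b [m gbm]] := gen g.
  exists (Ordinal (ltn_pmod m d_gt0)) => v; symmetry; move: v.
  by apply/(eE f _ b m) => [v|]; rewrite /= ?modn_mod // gE gbm.
exists rho; split=> // s i i'; rewrite rhoE; congr (nat_of_bool _)%:R.
apply/asboolP/idP; rewrite (eE (s \o e i') i (beta s) (i' * k ^ beta s + mu s)%N) //.
all: move=> v; rewrite /= actE -galM ?memvf // mulgA.
all: by rewrite (metacyclic_swap xc) -mulgA -expgD.
Qed.

End Embeddings.

(** * Fields of character values *)

Section CharacterFields.
Variables (R : realType) (m : nat) (rho : artin_rep R m).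
Local Notation C := R[i].
Local Notation ev w t := (map_poly ratr t : {poly C}).[w].

Lemma char_field_rat (y : C) :
  (forall s, exists q : rat, \tr (rho s) = ratr q) -> char_field rho y ->
  exists q : rat, y = ratr q.
Proof.
move=> rho_rat y_char; apply: (y_char (fun y : C => exists q : rat, y = ratr q)) => //.
split.
- by exists 1; rewrite rmorph1.
- move=> _ _ [q ->] [q' ->]; split; first by exists (q - q'); rewrite rmorphB.
  by exists (q * q'); rewrite rmorphM.
- by move=> _ [q ->]; exists q^-1; rewrite fmorphV.
Qed.

Variables (n : nat) (z : C).
Hypothesis z_prim : n.-primitive_root z.

Lemma cyclotomic_subfield : subfield_set [set y : C | exists t : {poly rat}, y = ev z t].
Proof.
split.
- by exists 1; rewrite rmorph1 hornerC.
- move=> _ _ [t ->] [t' ->]; split.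
    by exists (t - t'); rewrite rmorphB /= hornerD hornerN.
  by exists (t * t'); rewrite rmorphM /= hornerM.
move=> _ [t ->]; have [t0|t0] := eqVneq (ev z t) 0.
  by exists 0; rewrite t0 invr0 rmorph0 horner0.
have : coprimep (map_poly intr 'Phi_n) t.
  apply: (Cyclotomic_coprime (prim_order_gt0 z_prim)).
  apply: contraNN t0 => /dvdpP[u ->].
  by rewrite rmorphM /= hornerM horner_ratr_intr (zev_Cyclotomic z_prim) mulr0.
case/Bezout_eq1_coprimepP => -[v u] /= uv1; exists u.
have /eqP := congr1 (fun t => ev z t) uv1.
rewrite rmorphD !rmorphM /= hornerD !hornerM horner_ratr_intr (zev_Cyclotomic z_prim) mulr0 add0r.
rewrite rmorph1 hornerC => /eqP ut.
by apply: (mulIf t0); rewrite mulVf.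
Qed.

Hypothesis rho_trace : forall s, exists2 t : {poly rat}, \tr (rho s) = ev z t &
  forall a, coprime a n -> exists s', \tr (rho s') = ev (z ^+ a) t.

Lemma char_field_cyclotomic y : char_field rho y -> exists t : {poly rat}, y = ev z t.
Proof.
move=> y_char; apply: (y_char (fun y : C => exists t : {poly rat}, y = ev z t)).
  exact: cyclotomic_subfield.
by move=> s; have [t tE _] := rho_trace s; exists t.
Qed.

Lemma ev_conj a (t t' : {poly rat}) : coprime a n -> ev z t = ev z t' ->
  ev (z ^+ a) t = ev (z ^+ a) t'.
Proof.
move=> an tt'; apply/eqP; rewrite -subr_eq0 -hornerN -hornerD -rmorphB.
apply/eqP/(Galois_conjugate z_prim an).
by rewrite rmorphB hornerD hornerN tt' subrr.
Qed.

(** For a field S containing the traces, the elements of Q(z) whose conjugate lies in S form a field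
    [S'] that again contains the traces, so it contains the whole character field. *)
Lemma char_field_conj a (t : {poly rat}) : coprime a n ->
  char_field rho (ev z t) -> char_field rho (ev (z ^+ a) t).
Proof.
move=> an tS S S_field S_tr.
pose S' (y : C) := exists2 u : {poly rat}, y = ev z u & S (ev (z ^+ a) u).
suff /tS : subfield_set S'.
  case=> [s|u tu uS]; last by rewrite (ev_conj an tu).
  have [u uE u_conj] := rho_trace s; exists u => //.
  by have [s' <-] := u_conj a an.
have [S1 S2 S3] := S_field; split.
- by exists 1; rewrite rmorph1 hornerC.
- move=> _ _ [u -> uS] [u' -> uS']; have [SB SM] := S2 _ _ uS uS'; split.
    by exists (u - u'); rewrite rmorphB /= hornerD hornerN.
  by exists (u * u'); rewrite rmorphM /= hornerM.
move=> _ [u -> uS]; have [S1' S2' /(_ (ev z u))] := cyclotomic_subfield.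
case=> [|v vE]; first by exists u.
exists v => //; suff -> : ev (z ^+ a) v = (ev (z ^+ a) u)^-1 by apply: S3.
have [u0|u0] := eqVneq (ev z u) 0.
  move: vE; rewrite u0 invr0 => /esym v0.
  by rewrite (Galois_conjugate z_prim an u0) (Galois_conjugate z_prim an v0) invr0.
have uv1 : ev (z ^+ a) (u * v) = ev (z ^+ a) 1.
  by apply: ev_conj => //; rewrite rmorphM rmorph1 /= hornerM hornerC -vE mulfV.
have {}uv1 : ev (z ^+ a) u * ev (z ^+ a) v = 1.
  by move: uv1; rewrite rmorphM rmorph1 /= hornerM hornerC.
have ua0 : ev (z ^+ a) u != 0.
  by apply: contra_eq_neq uv1 => ->; rewrite mul0r eq_sym oner_neq0.
by apply: (mulfI ua0); rewrite uv1 mulfV.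
Qed.

(** [tt] chooses a polynomial in z for each element of Q(z), with junk value 0 elsewhere; [ev_conj]
    makes the conjugate independent of the choice. Surjectivity uses an inverse a' of a mod n. *)
Lemma char_field_aut a : coprime a n -> exists g : C -> C,
  field_aut (char_field rho) g /\ forall t : {poly rat}, g (ev z t) = ev (z ^+ a) t.
Proof.
move=> an; have /choice[tt ttE] : forall y : C, exists t : {poly rat},
    (exists u : {poly rat}, y = ev z u) -> y = ev z t.
  move=> y; have [[u yu]|yu] := pselect (exists u : {poly rat}, y = ev z u).
    by exists u.
  by exists 0 => /yu.
have gE t : ev (z ^+ a) (tt (ev z t)) = ev (z ^+ a) t.
  by apply: ev_conj => //; rewrite -ttE //; exists t.
exists (fun y => ev (z ^+ a) (tt y)); split=> //; split.
- by have := gE 1; rewrite rmorph1 !hornerC.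
- move=> x y /char_field_cyclotomic[t ->] /char_field_cyclotomic[u ->]; split.
    have evD w : ev w (t + u) = ev w t + ev w u by rewrite rmorphD hornerD.
    by rewrite -evD !gE evD.
  have evM w : ev w (t * u) = ev w t * ev w u by rewrite rmorphM hornerM.
  by rewrite -evM !gE evM.
- move=> x xS; have [t xE] := char_field_cyclotomic xS.
  by move: xS; rewrite xE gE; apply: char_field_conj.
move=> y yS; have [t yE] := char_field_cyclotomic yS.
have [a' aa'] : exists a', (a' * a = 1 %[mod n])%N.
  exists (a ^ (totient n).-1)%N; rewrite mulnC -expnS prednK ?Euler_exp_totient //.
  by rewrite totient_gt0 (prim_order_gt0 z_prim).
have a'n : coprime a' n.
  have : coprime (a' * a) n by rewrite -coprime_modl aa' coprime_modl coprime1n.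
  by rewrite coprimeMl => /andP[].
exists (ev (z ^+ a') t); first by apply: char_field_conj => //; rewrite -yE.
have -> : ev (z ^+ a') t = ev z (t \Po 'X^a').
  by rewrite map_comp_poly map_polyXn horner_comp hornerXn.
rewrite gE map_comp_poly map_polyXn horner_comp hornerXn -exprM.
rewrite yE; congr (_.[_]); rewrite -[RHS]expr1; apply/eqP.
by rewrite (eq_prim_root_expr z_prim) mulnC aa'.
Qed.

End CharacterFields.

(** * Consequences of the conjecture in rank 0 *)

Lemma mw_basis_rank_ge1 (K : fieldType) (W : weierstrass K) m (P : 'I_m.+1 -> Defs.point K) :
  mw_basis W P -> rank_ge W 1.
Proof.
case=> -[P_on P_ind] _; exists (fun=> P ord0); split=> [_|n n_tors i]; first exact: P_on.
pose n' (i : 'I_m.+1) : int := if i == ord0 then n ord0 else 0.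
suff /P_ind/(_ ord0) : torsion W (lincomb W P n') by rewrite /n' eqxx (ord1 i).
suff <- : lincomb W (fun=> P ord0) n = lincomb W P n' by [].
rewrite /lincomb !big_ord_recl big_ord0 /n' eqxx; congr padd.
by apply/esym; apply: (big_ind (fun Q => Q = None)) => // Q Q' -> ->.
Qed.

(** Galois acts on an empty basis through 0 x 0 matrices, of trace 0. Thus the multiplicity
    hypothesis of (C5) holds for every representation. *)
Lemma mw_mult_rank0 (R : realType) (K : splittingFieldType rat) (iota : {rmorphism K -> algC})
    (W : weierstrass rat) (P : 'I_0 -> Defs.point K) m (rho : artin_rep R m) :
  galois 1 {:K} -> mw_basis (wbase W K) P -> mw_mult iota W rho 0.
Proof.
move=> K_gal P_basis; have [lift liftP] := lift_exists iota.
exists 0%N, P, (fun=> 0), lift; split=> // [g []//|].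
by rewrite big1 ?mulr0 // => g _; rewrite [X in (X)%:~R]/mxtrace big_ord0 mulr0.
Qed.

(* The conjecture makes BSD(E/K) nonzero, hence also its regulator, which by
   its definition through xget requires a basis of E(K) modulo torsion to exist. *)
Lemma BSD_mw_basis (R : realType) (W : weierstrass rat) (K : fieldExtType rat) :
  BSD R W K != 0 -> exists m (P : 'I_m -> Defs.point K), mw_basis (wbase W K) P.
Proof.
move=> BSD0; apply: contrapT => no_basis; move/eqP: BSD0; apply.
rewrite /BSD [regulator _ _]xgetPN ?mul0r // => y [m [P [P_basis _]]].
by apply: no_basis; exists m, P.
Qed.

(** * Subgroups of the cyclic normal subgroup and their products with the complement *)

Section SubgroupIndex.
Variables (gT : finGroupType) (x c : gT) (k n : nat).
Hypotheses (xc : (x ^ c = x ^+ k)%g) (xIc : (<[x]> :&: <[c]> = 1)%g) (ox : #[x]%g = n).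
Local Open Scope group_scope.

Lemma cyclic_subgroup_mem (Q : {group gT}) d i : Q \subset <[x]> -> (#|Q| * d = n)%N ->
  (x ^+ i \in Q) = (d %| i)%N.
Proof.
move=> Qx Qd; have Q0 := cardG_gt0 Q.
have QE : Q = <[x ^+ d]>%G.
  apply/eqP; rewrite -val_eqE /= (eq_subG_cyclic (cycle_cyclic x)) ?cycleX //.
  rewrite -orderE orderXdiv ox -Qd ?dvdn_mull // mulnK //.
  by move: (order_gt0 x); rewrite ox -Qd muln_gt0 => /andP[].
apply/idP/idP => [xQ|/dvdnP[i' ->]]; last first.
  by rewrite QE mulnC expgM mem_cycle.
have := expg_cardG xQ; rewrite -expgM => /eqP; rewrite -order_dvdn ox -Qd mulnC.
by rewrite dvdn_pmul2r.
Qed.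

Lemma semidirect_subgroup_mem (Q H : {group gT}) d i : Q \subset <[x]> ->
  (#|Q| * d = n)%N -> H = (Q * <[c]>)%g :> {set gT} -> (x ^+ i \in H) = (d %| i)%N.
Proof.
move=> Qx Qd HE; rewrite -(cyclic_subgroup_mem i Qx Qd).
have := group_modl <[c]> Qx; rewrite finset.setIC xIc mulg1 => QE.
by rewrite QE inE mem_cycle andbT -HE.
Qed.

Lemma join_cycle (Q : {group gT}) : Q \subset <[x]> -> Q <*> <[c]> = Q * <[c]>.
Proof.
move=> Qx; apply: norm_joinEr; apply: char_norm_trans (_ : Q \char <[x]>) _.
  by rewrite sub_cyclic_char ?cycle_cyclic.
by rewrite cycle_subG inE -cycleJ xc cycleX.
Qed.

Lemma action_nontrivial (Q : {group gT}) d : Q \subset <[x]> -> (#|Q| * d = n)%N ->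
  ~~ (<[c]> \subset 'C(Q)) -> (k <> 1 %[mod #|Q|])%N.
Proof.
move=> Qx Qd /negP nc k1; apply: nc; rewrite centsC; apply/fintype.subsetP => y yQ.
have /cycleP[i yE] := fintype.subsetP Qx y yQ; rewrite yE.
have di : (d %| i)%N by rewrite -(cyclic_subgroup_mem i Qx Qd) -yE.
rewrite cent_cycle; apply/cent1P/commgP/conjg_fixP.
rewrite conjXg xc -expgM; apply/eqP; rewrite eq_expg_mod_order ox -Qd.
by case/dvdnP: di => i' ->; rewrite mulnA -!muln_modl -modnMml k1 modnMml mul1n.
Qed.

End SubgroupIndex.

Lemma trivial_rep_ind (R : realType) :
  is_ind_triv (rat^o : fieldExtType rat) (trivial_rep R).
Proof.
have [f _] := num_field_embedding (rat^o : fieldExtType rat).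
have ratE (g h : {rmorphism (rat^o : fieldExtType rat) -> algC}) : g =1 h.
  by move=> y; rewrite (fmorph_eq_rat (g : {rmorphism rat -> algC}))
                       (fmorph_eq_rat (h : {rmorphism rat -> algC})).
exists (fun=> f); split=> [i i' _|g|s i i'].
- by rewrite !ord1.
- by exists ord0.
rewrite mxE !ord1 eqxx; by case: asboolP => // nE; case: nE; apply: (ratE f (s \o f)).
Qed.

(** * Rationality and Galois conjugation of the values of B *)

Section Assembly.
Variables (R : realType) (F : splittingFieldType rat) (iota : {rmorphism F -> algC}).
Hypothesis F_gal : galois 1 {:F}.
Variables (x c : gal_of {:F}) (k : nat).
Hypotheses (xc : (x ^ c = x ^+ k)%g) (xIc : (<[x]> :&: <[c]> = 1)%g).
Hypothesis gen : forall g : gal_of {:F}, exists b m, g = (c ^+ b * x ^+ m)%g.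
Local Notation C := R[i].
Local Notation n := #[x]%g.
Local Notation r := #[c]%g.
Hypothesis kr : (k ^ r = 1 %[mod n])%N.
Variables (z : C) (beta mu : absgal -> nat).
Hypothesis z_prim : n.-primitive_root z.
Hypothesis actE : forall (s : absgal) y, s (iota y) = iota ((c ^+ beta s * x ^+ mu s)%g y).

Local Notation mono := (monomial z_prim (order_gt0 c) kr (@action_mul _ _ _ _ _ xc xIc _ _ actE)
  (action_cont xIc actE)).

Lemma action_surj b m : exists s : absgal, (beta s = b %[mod r])%N /\ (mu s = m %[mod n])%N.
Proof.
have [lift liftE] := lift_exists iota.
exists (lift (c ^+ b * x ^+ m)%g); apply: (metacyclic_inj xIc).
by apply: (gal_iota_eq (iota := iota)) => y; rewrite -actE liftE.
Qed.

Variables (E : weierstrass rat) (B : forall m, artin_rep R m -> C).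
Hypothesis B_C5 : C5 E B.
Variable P : 'I_0 -> Defs.point F.
Hypothesis P_basis : mw_basis (wbase E F) P.

Lemma monomial_factors j : factors_through iota (mono j).
Proof.
move=> s /(action_fixes xIc actE)[b0 m0].
exact: (@monomial_id R _ _ k z beta mu z_prim (order_gt0 c) j s b0 m0).
Qed.

(** The automorphism z -> z^a carries the character of [mono 1] to that of [mono a], so (C5)
    conjugates the value accordingly. The polynomial f represents B of [mono 1] in Q(z). *)
Lemma B_monomial_conj : exists f : {poly rat}, forall a, coprime a n ->
  B (mono a) = (map_poly ratr f).[z ^+ a].
Proof.
have [B1 _ B_conj] := B_C5 (monomial_factors 1) (mw_mult_rank0 iota _ F_gal P_basis).
have trP s : exists2 t : {poly rat}, \tr (mono 1 s) = (map_poly ratr t).[z] &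
    forall a, coprime a n -> exists s', \tr (mono 1 s') = (map_poly ratr t).[z ^+ a].
  exists (monomial_trace_poly k (order_gt0 c) (beta s) (mu s)).
    by rewrite monomial_trace expr1.
  move=> a an; have [s' [b' m']] := action_surj (beta s) (a * mu s).
  by exists s'; apply: monomial_trace_conj.
have [f fE] := char_field_cyclotomic z_prim trP B1.
exists f => a an; have [g [g_aut gE]] := char_field_aut z_prim trP an.
rewrite (B_conj g (mono a)) //; first by rewrite fE gE.
by move=> s; rewrite !monomial_trace expr1 gE.
Qed.

(** A permutation character has integer values, so (C5) places the value of B in the rationals. *)
Lemma B_permutation_rat d (rho : artin_rep R d) : (d %| n)%N ->
  (forall s (i i' : 'I_d), rho s i i' = (i == i' * k ^ beta s + mu s %[mod d])%:R) ->
  exists q : rat, B rho = ratr q.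
Proof.
move=> dn rhoE.
have rho_factors : factors_through iota rho.
  move=> s /(action_fixes xIc actE)[b0 m0]; apply/matrixP => i i'; rewrite rhoE mxE.
  have kb : (k ^ beta s = 1 %[mod d])%N.
    have := expn_mod_order kr b0; rewrite expn0 => kb.
    by rewrite -(modn_dvdm _ dn) kb modn_dvdm.
  have m0' : (mu s = 0 %[mod d])%N by rewrite -(modn_dvdm _ dn) m0 modn_dvdm.
  by rewrite -modnDmr m0' modnDmr addn0 -modnMmr kb modnMmr muln1 !modn_small.
have [B1 _ _] := B_C5 rho_factors (mw_mult_rank0 iota _ F_gal P_basis).
apply: char_field_rat B1 => s; exists (\sum_(i < d) (i == i * k ^ beta s + mu s %[mod d])%:R).
by rewrite rmorph_sum; apply: eq_bigr => i _; rewrite rhoE /= ratr_nat.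
Qed.

Lemma B_trivial_rat : exists q : rat, B (trivial_rep R) = ratr q.
Proof.
have tf : factors_through iota (trivial_rep R) by [].
have [B1 _ _] := B_C5 tf (mw_mult_rank0 iota _ F_gal P_basis).
apply: char_field_rat B1 => s; exists 1.
by rewrite rmorph1 mxtrace1.
Qed.

End Assembly.

(** Makes (C1) applicable to F itself: BSD(E/F) is then a value of B, hence nonzero, and a basis of
    E(F) modulo torsion can be extracted from it. *)
Lemma splitting_ind_triv (R : realType) (F : splittingFieldType rat) : galois 1 {:F} ->
  exists m (rho : artin_rep R m), is_ind_triv F rho.
Proof.
move=> F_gal; have [iota _] := num_field_embedding F.
pose e (i : 'I_#|{: gal_of {:F}}|) : {rmorphism F -> algC} := iota \o (enum_val i : gal_of {:F}).
have [||rho [rho_ind _]] := @ind_triv_exists R _ _ e; last by exists _, rho.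
  by move=> i i' ii'; apply: enum_val_inj; apply: (gal_iota_eq (iota := iota)).
move=> f; have [g gE] := embedding_gal iota F_gal idfun f.
by exists (enum_rank g) => y; rewrite /= enum_rankK gE.
Qed.

(** The two local results are combined crosswise: at p, the quotient y / (p^a q^b) is the p-unit
    m/d, congruent to 1, divided by q^b, which is 1 mod p by the result at q. *)
Lemma norm_two_primes (C : numFieldType) p q (z : C) (f : {poly rat}) Tp Tq (y : rat) :
  prime p -> prime q -> p != q -> (p * q).-primitive_root z ->
  perm_eq [seq (q * b %% p)%N | b <- Tp] Tp -> all (coprime p) Tp ->
  perm_eq [seq (p * b %% q)%N | b <- Tq] Tq -> all (coprime q) Tq ->
  y != 0 ->
  ratr y = \prod_(b <- Tq) \prod_(1 <= a < p)
             (map_poly ratr f).[z ^+ chinese p q a b] ->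
  ratr y = \prod_(b <- Tp) \prod_(1 <= a < q)
             (map_poly ratr f).[z ^+ chinese q p a b] ->
  exists (a b : int) (m : rat),
    rat_eq1_mod m (p * q) /\ y = p%:R ^ a * q%:R ^ b * m.
Proof.
move=> p_pr q_pr pq z_prim TpP Tp_cop TqP Tq_cop y0 yq yp.
have z_prim' : (q * p).-primitive_root z by rewrite mulnC.
have qp : q != p by rewrite eq_sym.
have [a [m [d [pm pd md ya pa1]]]] := norm_prime_part p_pr q_pr pq z_prim TqP Tq_cop y0 yq.
have [b [m' [d' [qm qd md' yb qb1]]]] :=
  norm_prime_part q_pr p_pr qp z_prim' TpP Tp_cop y0 yp.
have p0 : p%:R != 0 :> rat by rewrite pnatr_eq0 -lt0n prime_gt0.
have q0 : q%:R != 0 :> rat by rewrite pnatr_eq0 -lt0n prime_gt0.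
have [pa0 qb0] := (expfz_neq0 a p0, expfz_neq0 b q0).
exists a, b, (y / (p%:R ^ a * q%:R ^ b)); split; last first.
  by rewrite [RHS]mulrC divfK // mulf_neq0.
apply: local_one_eq1_mod => //.
  have -> : y / (p%:R ^ a * q%:R ^ b) = m%:~R / d%:~R * (q%:R ^ b)^-1.
    by rewrite ya invfM mulrACA divff // mul1r.
  apply: local_oneM => //; first by exists m, d.
  exact/local_oneV/local_one_exp.
have -> : y / (p%:R ^ a * q%:R ^ b) = m'%:~R / d'%:~R * (p%:R ^ a)^-1.
  by rewrite yb invfM [_^-1 * _]mulrC mulrACA divff // mul1r.
apply: local_oneM => //; first by exists m', d'.
exact/local_oneV/local_one_exp.
Qed.

Theorem theorem3p4 (R : realType) (q1 q2 r : nat)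
  (q1_prime : prime q1) (q2_prime : prime q2) (r_prime : prime r)
  (q1_odd : odd q1) (q2_odd : odd q2) (r_odd : odd r)
  (q1q2 : q1 != q2) (q1r : q1 != r) (q2r : q2 != r)
  (q1_mod_r : (q1 = 1 %[mod r])%N) (q2_mod_r : (q2 = 1 %[mod r])%N)
  (q1_mod_r2 : (q1 <> 1 %[mod r ^ 2])%N)
  (q2_mod_r2 : (q2 <> 1 %[mod r ^ 2])%N)
  (q1_power : rth_power_mod r q1 q2) (q2_power : rth_power_mod r q2 q1)
  (hC : conjecture_C R)
  (E : weierstrass rat) (hE : elliptic E)
  (F : splittingFieldType rat) (hF : galois 1%VS {:F}%VS)
  (N Q1 Q2 P : {group gal_of {:F}%VS})
  (hG : sdprod N P = 'Gal({:F}%VS / 1%VS)%g)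
  (N_cyclic : cyclic N) (cardN : #|N| = (q1 * q2)%N) (cardP : #|P| = r)
  (Q1N : Q1 \subset N) (cardQ1 : #|Q1| = q1)
  (Q2N : Q2 \subset N) (cardQ2 : #|Q2| = q2)
  (P_acts_Q1 : ~~ (P \subset 'C(Q1))%g) (P_acts_Q2 : ~~ (P \subset 'C(Q2))%g) :
  rank_ge (wbase E F) 1 \/
  exists (a b : int) (m : rat),
    rat_eq1_mod m (q1 * q2) /\
    BSD R E (subvs_of (fixedField P)) * BSD R E (rat^o : fieldExtType rat)
      / (BSD R E (subvs_of (fixedField (Q1 <*> P)%g)) *
         BSD R E (subvs_of (fixedField (Q2 <*> P)%g)))
    = q1%:R ^ a * q2%:R ^ b * ratr m :> R.
Proof.
have [B [B0 B_iso [HC1 HC2 _ _ [HC5 _]]]] := hC E hE.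
have [rk_ge1|rk0] := pselect (rank_ge (wbase E F) 1); [by left | right].
have [P0 P0_basis] : exists P0 : 'I_0 -> Defs.point F, mw_basis (wbase E F) P0.
  have [d [rho rho_ind]] := splitting_ind_triv R hF.
  have BSD0 : BSD R E F != 0.
    by rewrite -(fmorph_eq0 (real_complex R)) /= ((HC1 F).2 _ _ rho_ind) B0.
  have [[|m] [P0 P0_basis]] := BSD_mw_basis BSD0; first by exists P0.
  by case: rk0; apply: mw_basis_rank_ge1 P0_basis.
have [emb _] := num_field_embedding F.
have [r_gt0 q1_gt0 q2_gt0] := And3 (prime_gt0 r_prime) (prime_gt0 q1_prime) (prime_gt0 q2_prime).
have [x NE] := cyclicP N_cyclic; have [c PE] : exists c, P = <[c]>%g :> {set _}.
  by apply/cyclicP; rewrite prime_cyclic // cardP.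
have ox : #[x]%g = (q1 * q2)%N by rewrite orderE -NE.
have oc : #[c]%g = r by rewrite orderE -PE.
have [_ _ NP PN xIc] := sdprod_context hG; rewrite NE PE in xIc.
have [k xc] : exists k, (x ^ c = x ^+ k)%g.
  apply/cycleP; rewrite -NE memJ_norm ?NE ?cycle_id // -NE.
  by apply: (fintype.subsetP PN); rewrite PE cycle_id.
have gen (g : gal_of {:F}) : exists b m, g = (c ^+ b * x ^+ m)%g.
  have := gal_full g; rewrite -NP -(normC PN) NE PE.
  by case/mulsgP=> _ _ /cycleP[b ->] /cycleP[m ->] ->; exists b, m.
have [beta [mu actE]] := action_exists emb hF gen.
have kr : (k ^ #[c]%g = 1 %[mod #[x]%g])%N.
  apply/eqP; rewrite -eq_expg_mod_order expg1; apply/eqP/esym.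
  by have := metacyclic_conj xc 1 #[c]%g; rewrite expg_order conjg1 expg1 mul1n.
have x_gt0 := order_gt0 x.
have [z z_prim] : exists z : R[i], (#[x]%g).-primitive_root z.
  by apply: closed_prim_root_exists; rewrite pnatr_eq0 -lt0n.
have Q1x : Q1 \subset <[x]>%g by rewrite -NE.
have Q2x : Q2 \subset <[x]>%g by rewrite -NE.
have Q1n : (#|Q1| * q2 = #[x]%g)%N by rewrite cardQ1 ox.
have Q2n : (#|Q2| * q1 = #[x]%g)%N by rewrite cardQ2 ox mulnC.
have k1_q1 : (k <> 1 %[mod q1])%N.
  by rewrite -cardQ1; apply: (action_nontrivial xc _ Q1x Q1n); rewrite -?PE.
have k1_q2 : (k <> 1 %[mod q2])%N.
  by rewrite -cardQ2; apply: (action_nontrivial xc _ Q2x Q2n); rewrite -?PE.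
have kr_dvd q : (q %| q1 * q2)%N -> (k ^ r = 1 %[mod q])%N.
  by move=> qn; rewrite -(modn_dvdm _ qn) -oc -ox kr ox modn_dvdm.
have kr1 := kr_dvd _ (dvdn_mulr q2 (dvdnn q1)).
have kr2 := kr_dvd _ (dvdn_mull q1 (dvdnn q2)).
have k_cop q : (k ^ r = 1 %[mod q])%N -> coprime q k.
  by move=> kq; rewrite -(coprime_pexpr _ _ r_gt0) -coprime_modr kq coprime_modr coprimen1.
have q1_q2 : coprime q1 q2 by rewrite prime_coprime // dvdn_prime2.
pose T1 := power_residues q1 r; pose T2 := power_residues q2 r.
have T1_uniq : uniq T1 by rewrite filter_uniq ?iota_uniq.
have T2_uniq : uniq T2 by rewrite filter_uniq ?iota_uniq.
have T1_cop : all (coprime q1) T1 by apply: power_residues_coprime.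
have T2_cop : all (coprime q2) T2 by apply: power_residues_coprime.
have T1_trans := power_residues_transversal q1_prime r_prime q1_mod_r q1_mod_r2 kr1 k1_q1.
have T2_trans := power_residues_transversal q2_prime r_prime q2_mod_r q2_mod_r2 kr2 k1_q2.
have xH (Q : {group gal_of {:F}}) d : Q \subset <[x]>%g -> (#|Q| * d = #[x]%g)%N ->
    forall i, (x ^+ i \in (Q <*> P)%G)%g = (d %| i)%N.
  move=> Qx Qd i; apply: (semidirect_subgroup_mem xIc erefl i Qx Qd).
  by rewrite /= PE (join_cycle xc).
have cH (Q : {group gal_of {:F}}) : c \in (Q <*> P)%G.
  by apply: (fintype.subsetP (joing_subr Q P)); rewrite PE cycle_id.
(* The indices are swapped: Q1 P has index q2, so [rho1] has dimension q2 and involves the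
   characters that are multiples of q1. *)
have [rho1 [rho1_ind rho1E]] :=
  fixedField_embeddings hF xc gen actE R q2_gt0 (cH Q1) (xH _ _ Q1x Q1n).
have [rho2 [rho2_ind rho2E]] :=
  fixedField_embeddings hF xc gen actE R q1_gt0 (cH Q2) (xH _ _ Q2x Q2n).
have cP : c \in P by rewrite PE cycle_id.
have xP i : (x ^+ i \in P)%g = (#[x]%g %| i)%N.
  by apply: (semidirect_subgroup_mem (Q := 1%G) xIc erefl); rewrite ?sub1G ?cards1 ?mul1n ?mul1g.
have [rho [rho_ind rhoE]] := fixedField_embeddings hF xc gen actE R x_gt0 cP xP.
have [f fE] := B_monomial_conj hF xc xIc kr z_prim actE HC5 P0_basis.
have [y0 y0E] := B_trivial_rat emb hF HC5 P0_basis.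
have [y yE] := B_permutation_rat hF xIc kr actE HC5 P0_basis (dvdnn _) rhoE.
have q1n : (q1 %| #[x]%g)%N by rewrite ox dvdn_mulr.
have q2n : (q2 %| #[x]%g)%N by rewrite ox dvdn_mull.
have [y1 y1E] := B_permutation_rat hF xIc kr actE HC5 P0_basis q2n rho1E.
have [y2 y2E] := B_permutation_rat hF xIc kr actE HC5 P0_basis q1n rho2E.
have Bperm := B_permutation z_prim (order_gt0 c) kr (action_mul xc xIc actE)
   (action_cont xIc actE) B_iso HC2.
pose b j := B _ (monomial z_prim (order_gt0 c) kr (action_mul xc xIc actE)
  (action_cont xIc actE) j).
have trans_small u q T : prime q ->
    perm_eq [seq (t * k ^ l %% q)%N | t <- T, l <- iota 0 r] (iota 1 q.-1) ->
    perm_eq (0%N :: [seq (j * k ^ l %% (u * q))%N | j <- [seq u * t | t <- T]%N, l <- iota 0 r])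
            [seq (u * t)%N | t <- iota 0 q].
  move=> q_pr /(residue_transversal_lift u) u_perm.
  have -> : iota 0 q = 0%N :: iota 1 q.-1 by rewrite -{1}(prednK (prime_gt0 q_pr)).
  by rewrite /= muln0 perm_cons.
have rho1B : B _ rho1 = B _ (trivial_rep R) * \prod_(j <- [seq q1 * t | t <- T2]%N) b j.
  apply: (Bperm _ _ q2n rho1E); rewrite ?oc ox mulnK //; first exact: trans_small.
  by apply/allP => _ /mapP[t _ ->]; rewrite dvdn_mulr.
have rho2B : B _ rho2 = B _ (trivial_rep R) * \prod_(j <- [seq q2 * t | t <- T1]%N) b j.
  apply: (Bperm _ _ q1n rho2E); rewrite ?oc ox mulKn // 1?mulnC; first exact: trans_small.
  by apply/allP => _ /mapP[t _ ->]; rewrite dvdn_mulr.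
have rhoB js : perm_eq (0%N :: [seq (j * k ^ l %% (q1 * q2))%N | j <- js, l <- iota 0 r])
    (iota 0 (q1 * q2)) -> B _ rho = B _ (trivial_rep R) * \prod_(j <- js) b j.
  move=> js_perm; apply: (Bperm _ _ (dvdnn _) rhoE); rewrite ?oc divnn x_gt0.
    by rewrite ox (eq_map mul1n) map_id.
  by apply/allP => j _; rewrite dvd1n.
pose J p q T := [seq chinese p q a t | t <- T, a <- index_iota 1 p].
have b0 j : b j != 0 by apply: B0.
have prod_neq0 js : \prod_(j <- js) b j != 0.
  by rewrite prodf_seq_neq0; apply/allP => j _; apply: b0.
pose X : rat := y * y0 / (y1 * y2).
have XE : ratr X = B _ rho * B _ (trivial_rep R) / (B _ rho1 * B _ rho2).
  by rewrite fmorph_div !rmorphM /= -yE -y0E -y1E -y2E.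
have X0 : X != 0.
  rewrite -(fmorph_eq0 (ratr : {rmorphism rat -> R[i]})) /= XE.
  by rewrite mulf_neq0 ?invr_neq0 ?mulf_neq0 ?B0.
(* The non-unit exponents cancel against [rho1] and [rho2], and the trivial factors cancel too. p, q
   and T are kept general because the units are represented in two different ways. *)
have JX p q T js : B _ rho = B _ (trivial_rep R) * \prod_(j <- js ++ J p q T) b j ->
    perm_eq js ([seq q2 * t | t <- T1]%N ++ [seq q1 * t | t <- T2]%N) ->
    ratr X = \prod_(j <- J p q T) b j.
  move=> rhoE' js_perm; rewrite XE rhoE' rho1B rho2B big_cat (perm_big _ js_perm) big_cat /=.
  have := B0 _ (trivial_rep R); set Bt := B _ _ => Bt0.
  have [p1 p2] := (prod_neq0 [seq q1 * t | t <- T2]%N, prod_neq0 [seq q2 * t | t <- T1]%N).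
  by field; rewrite Bt0 p1 p2.
have JE p q T : coprime p q -> (p * q = q1 * q2)%N -> prime p -> all (coprime q) T ->
    \prod_(j <- J p q T) b j =
    \prod_(t <- T) \prod_(1 <= a < p) (map_poly ratr f).[z ^+ chinese p q a t].
  move=> pq pqE p_pr T_cop; rewrite big_allpairs_dep /=.
  apply: eq_big_seq => t tT; apply: eq_big_seq => a; rewrite mem_index_iota => /andP[a0 ap].
  apply: fE; rewrite ox -pqE coprimeMr; apply/andP; split.
    by rewrite -coprime_modl chinese_modl // coprime_modl coprime_sym prime_coprime // gtnNdvd.
  by rewrite -coprime_modl chinese_modr // coprime_modl coprime_sym (allP T_cop).
have [||||||||a1 [a2 [m [m1 Xm]]]] :=
  @norm_two_primes _ q1 q2 z f T1 T2 X q1_prime q2_prime q1q2.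
- by rewrite -ox.
- by apply: power_residues_mul => //; rewrite coprime_sym.
- exact: T1_cop.
- by apply: power_residues_mul => //; rewrite coprime_sym.
- exact: T2_cop.
- exact: X0.
(* Representatives with all nonzero residues mod q1 and r-th powers mod q2; the next case exchanges
   the primes, giving the same X as another product. *)
- rewrite -JE //; apply: JX (perm_refl _); apply: rhoB; rewrite -catA.
  by apply: residue_transversal => //; apply: k_cop.
- rewrite -JE 1?mulnC 1?coprime_sym //.
  apply: (JX _ _ _ ([seq q1 * t | t <- T2]%N ++ [seq q2 * t | t <- T1]%N)).
    apply: rhoB; rewrite -catA [(q1 * q2)%N]mulnC.
    by apply: residue_transversal => //; [rewrite eq_sym | apply: k_cop | apply: k_cop].
  by rewrite perm_catC.
exists a1, a2, m; split=> //.
have <- : ratr X = q1%:R ^ a1 * q2%:R ^ a2 * ratr m :> R.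
  by rewrite Xm !rmorphM !fmorphXz !rmorph_nat.
apply: (fmorph_inj (real_complex R)).
transitivity (ratr X : R[i]); last first.
  exact/esym/(fmorph_eq_rat (real_complex R \o ratr)).
rewrite XE -((HC1 _).2 _ _ rho_ind) -((HC1 _).2 _ _ (trivial_rep_ind R)).
rewrite -((HC1 _).2 _ _ rho1_ind) -((HC1 _).2 _ _ rho2_ind).
by rewrite fmorph_div !rmorphM.
Qed.
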